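(* Let $N\geq 5$. For all $u\in C_{0}^{\infty}(\mathbb{R}^{N})$ we have: (a) $$\int_{\mathbb{R}^{N}}|\Delta u|^{2}\,dx\geq\int_{\mathbb{R}^{N}}\left(N+2-|x|^{2}\right)|\nabla u|^{2}\,dx.$$ (b) $$\int_{\mathbb{R}^{N}}|\Delta u|^{2}\,dx\geq\int_{\mathbb{R}^{N}}\left(\frac{N+1}{|x|}-1\right)|\nabla u|^{2}\,dx.$$ (c) For every real $b<1$, $$\int_{\mathbb{R}^{N}}|\Delta u|^{2}\,dx\geq\int_{\mathbb{R}^{N}}\left(\frac{N+1-b}{|x|^{b+1}}-\frac{1}{|x|^{2b}}\right)|\nabla u|^{2}\,dx.$$ (d) For every real $b>1$, $$\int_{\mathbb{R}^{N}}|\Delta u|^{2}\,dx\geq\int_{\mathbb{R}^{N}}\left(\frac{N+b-1}{|x|^{b+1}}-\frac{1}{|x|^{2b}}\right)|\nabla u|^{2}\,dx.$$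
   Context: $C_0^\infty(\mathbb{R}^N)$ is the space of smooth functions with compact support in $\mathbb{R}^N$. Integrals are understood as extended-real-valued (in (d) the integrand on the right is nonpositive near the origin, so the right-hand side may equal $-\infty$). *)

(* Defs.v *)
From HB Require Import structures.
From mathcomp Require Import all_boot all_order all_algebra.
From mathcomp Require Import all_classical all_reals all_analysis.

Set Implicit Arguments.
Unset Strict Implicit.
Unset Printing Implicit Defensive.

Import Order.TTheory GRing.Theory Num.Theory.
Import numFieldNormedType.Exports.

Local Open Scope classical_set_scope.
Local Open Scope ring_scope.

Definition tcons (T : Type) (n : nat) (p : T * n.-tuple T) : n.+1.-tuple T :=
  [tuple of p.1 :: p.2].

Lemma measurable_tcons d (T : measurableType d) n :
  measurable_fun [set: T * n.-tuple T] (@tcons T n).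
Proof. exact: measurable_cons. Qed.

Lemma measurable_preimage_tcons d (T : measurableType d) n
    (A : set (n.+1.-tuple T)) :
  measurable A -> measurable (@tcons T n @^-1` A).
Proof.
by move=> mA; rewrite -[X in measurable X]setTI; exact: measurable_tcons.
Qed.

(* The library's instance of this fact is shadowed by the one for
   sub-probability measures, so inference does not find it. *)
Lemma product_measure1_sigma_finite (R : realType) d1 d2
    (T1 : measurableType d1) (T2 : measurableType d2)
    (m1 : {sigma_finite_measure set T1 -> \bar R})
    (m2 : {sigma_finite_measure set T2 -> \bar R}) :
  sigma_finite setT (m1 \x m2)%E.
Proof.
have /sigma_finiteP[F [TF ndF Foo]] := sigma_finiteT m1.
have /sigma_finiteP[G [TG ndG Goo]] := sigma_finiteT m2.
exists (fun n => F n `*` G n).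
  rewrite -setXTT TF TG predeqE => -[x y]; split.
    move=> [/= [n _ Fnx] [k _ Gky]]; exists (maxn n k) => //; split.
    - by move: x Fnx; exact/subsetPset/ndF/leq_maxl.
    - by move: y Gky; exact/subsetPset/ndG/leq_maxr.
  by move=> [n _ []/= ? ?]; split; exists n.
move=> k; have [? ?] := Foo k; have [? ?] := Goo k.
split; first exact: measurableX.
by rewrite product_measure1E// lte_mul_pinfty// ge0_fin_numE.
Qed.

Section product_succ.
Context (R : realType) d (T : measurableType d) (n : nat).
Variable m : {sigma_finite_measure set T -> \bar R}.
Variable mn : {sigma_finite_measure set (n.-tuple T) -> \bar R}.

Definition product_succ : set (n.+1.-tuple T) -> \bar R :=
  pushforward (m \x mn)%E (@tcons T n).

Let product_succ0 : product_succ set0 = 0%E.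
Proof. by rewrite /product_succ /pushforward preimage_set0 measure0. Qed.

Let product_succ_ge0 A : (0 <= product_succ A)%E.
Proof. by rewrite /product_succ /pushforward; exact: measure_ge0. Qed.

Let product_succ_sigma_additive : semi_sigma_additive product_succ.
Proof.
move=> F mF tF mUF; rewrite /product_succ /pushforward preimage_bigcup.
apply: measure_semi_sigma_additive => [k||].
- exact: measurable_preimage_tcons.
- apply/trivIsetP => i j _ _ ij; rewrite -preimage_setI.
  by move/trivIsetP : tF => ->//; rewrite preimage_set0.
- by rewrite -preimage_bigcup; exact: measurable_preimage_tcons.
Qed.

HB.instance Definition _ := isMeasure.Build _ _ _ product_succ
  product_succ0 product_succ_ge0 product_succ_sigma_additive.

Let product_succ_sigma_finite : sigma_finite setT product_succ.
Proof.
have [F FT Foo] := product_measure1_sigma_finite m mn.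
pose g (t : n.+1.-tuple T) : T * n.-tuple T := (thead t, [tuple of behead t]).
have gK : cancel (@tcons T n) g.
  by move=> [x t]; congr pair; apply/val_inj.
have mg : measurable_fun setT g.
  apply: measurable_fun_pair; first exact: measurable_tnth.
  exact: measurable_behead.
exists (fun k => g @^-1` F k).
  by rewrite -preimage_bigcup -FT preimage_setT.
move=> k; have [mFk Fkoo] := Foo k; split.
  by rewrite -[X in measurable X]setTI; exact: mg.
rewrite /product_succ /pushforward.
rewrite (_ : _ @^-1` _ = F k)//.
by apply/seteqP; split => x /=; rewrite gK.
Qed.

HB.instance Definition _ := Measure_isSigmaFinite.Build _ _ _ product_succ
  product_succ_sigma_finite.

End product_succ.

(* The n-fold product of m with itself, on n.-tuple T equipped with the product
   sigma-algebra: the Dirac mass on the one-point space T^0, then m \x (the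
   n-fold product), transported along the isomorphism T * T^n -> T^(n+1). *)
Fixpoint product_pow (R : realType) d (T : measurableType d)
    (m : {sigma_finite_measure set T -> \bar R}) (n : nat) :
    {sigma_finite_measure set (n.-tuple T) -> \bar R} :=
  match n with
  | 0 => \d_([tuple] : 0.-tuple T)
  | n'.+1 => product_succ m (product_pow m n')
  end.

Lemma product_pow_box (R : realType) d (T : measurableType d)
    (m : {sigma_finite_measure set T -> \bar R}) (n : nat) (A : 'I_n -> set T) :
  (forall i, measurable (A i)) ->
  product_pow m n [set t | forall i, A i (tnth t i)] =
  (\prod_(i < n) m (A i))%E.
Proof.
elim: n A => [|n IH] A mA.
  by rewrite big_ord0 /= diracE mem_set//= => -[].
rewrite big_ord_recl -IH; last by move=> i; exact: mA.
rewrite /= /product_succ /pushforward.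
rewrite (_ : _ @^-1` _ =
  A ord0 `*` [set t : n.-tuple T | forall i, A (lift ord0 i) (tnth t i)]).
  rewrite product_measure1E//.
  rewrite (_ : mkset _ = \bigcap_i
     ((fun t : n.-tuple T => tnth t i) @^-1` A (lift ord0 i))).
    apply: fin_bigcap_measurable => // i _.
    by rewrite -[X in measurable X]setTI; apply: measurable_tnth.
  by apply/seteqP; split => t /= h i; [move=> _|]; exact: h.
apply/seteqP; split => -[x t] /=.
  move=> h; split; first exact: (h ord0).
  by move=> i; move: (h (lift ord0 i)); rewrite /tcons tnthS.
move=> [h0 h] i; have [j ->|->//] := unliftP ord0 i; rewrite /tcons tnthS.
exact: h.
Qed.

Definition lebesgueN (R : realType) (N : nat) :
    {sigma_finite_measure set (N.-tuple (measurableTypeR R)) -> \bar R} :=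
  product_pow (@lebesgue_measure R) N.

Section calculus.
Context (R : realType) (N : nat).
Implicit Types (u f : 'rV[R]_N -> R) (x : 'rV[R]_N).

Definition vec_of_tuple (t : N.-tuple R) : 'rV[R]_N := \row_i tnth t i.

Definition integralRN f : \bar R :=
  (\int[lebesgueN R N]_t (f (vec_of_tuple t))%:E)%E.

(* The library norm on 'rV[R]_N is the sup norm; this is the Euclidean one. *)
Definition enorm x : R := Num.sqrt (\sum_i x 0 i ^+ 2).

Definition partial (i : 'I_N) f : 'rV[R]_N -> R :=
  fun x => 'D_(delta_mx 0 i) f x.

Definition grad u x : 'rV[R]_N := \row_i partial i u x.

Definition laplacian u x : R := \sum_i partial i (partial i u) x.

Definition smooth f : Prop :=
  forall s : seq 'I_N, let g := foldr partial f s in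
    continuous g /\ forall i x, derivable g x (delta_mx 0 i).

Definition compactly_supported f : Prop :=
  compact (closure [set x | f x != 0]).

Definition test_function f : Prop := smooth f /\ compactly_supported f.

End calculus.

(* Main.v *)
Require Import Defs.
From mathcomp Require Import all_boot all_order all_algebra.
From mathcomp Require Import all_classical all_reals all_analysis.
From mathcomp Require Import measurable_realfun.
From mathcomp Require Import ring lra.

Import Order.TTheory GRing.Theory Num.Theory.
Import numFieldNormedType.Exports.

Set Implicit Arguments.
Unset Strict Implicit.
Unset Printing Implicit Defensive.

Local Open Scope classical_set_scope.
Local Open Scope ring_scope.

(** Write r = |x|, e = x / r, let p and tau be the radial and tangential parts of
the gradient of u, a = <D2u e, e>, q the tangential part of D2u e, and M the
compression of the Hessian D2u to the hyperplane orthogonal to e, with trace m.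
With w = r^(-b-1), there is an explicit vector field V away from the origin,
quadratic in the first and second derivatives of u, such that
  (lap u)^2 - ((N + 1 - b) w - w^2 r^2) |grad u|^2 = div V
    + (a - p/r + w r p)^2 + 2 |q + (w r / 2) tau|^2
    + (N-1)/(N-2) (|M|^2 - m^2 / (N-1))
    + ((w r^2 - 2)^2 / 2 + N - 5) |tau|^2 / r^2.
All terms after div V are nonnegative: the third by Cauchy-Schwarz for the trace
(hessian_trace_le), the last because N >= 5. The weight
(N + b - 1) w - w^2 r^2 is treated in the same way, with another V; the first two
squares become (a + (N-1) p/r - w r p)^2 and 2 |q + ((N-2)/r - w r / 2) tau|^2.
These are the lemmas residual_ge0_linear and residual_ge0_newtonian: the first
squares vanish on the radial functions with p = r exp(-phi), respectively
p = r^(1-N) exp(phi), where phi' = w r. Inequalities (a)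
and (b) are the cases b = -1 and b = 0 of (c).

It remains to integrate. The field V is a combination of five fields whose
divergences are computed with an arbitrary radial weight. They are singular at
the origin, so they are multiplied by a radial cutoff that vanishes near it; the
divergence theorem for compactly supported fields then applies, and the cutoff
costs an error zeta <x, V> / r^2, where 0 <= zeta <= 1 tends to 0 pointwise. This
flux is dominated by (lap u)^2 + |D2u|^2 + |grad u|^2 / r^2 + w |grad u|^2. The third
term is integrable by a Hardy inequality (integrableRN_hardy). As for the last
one, if the right-hand side of the inequality is the integral of an integrable
function, then completing squares shows that w |grad u|^2 is integrable as well, and
dominated convergence removes the cutoff. If it is not, the integral is -oo,
because the positive part of the weight is at most a multiple of 1 / r^2. Both
cases are in weighted_ineq.

The divergence theorem is proved by integrating along coordinate lines in the
iterated product measure. The identities use the symmetry of second derivatives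
(partial_sym). *)

(** * Pointwise inequalities for a gradient and a Hessian *)

Section pointwise.
Context (R : realFieldType).

(** Divergence, away from the origin, of the vector field
  (n-1)/(n-2) (L g - H g) - 2/(n-2) (x.g) (L x - H x) / t
    + 2 (x.g) g / t + c4 |g|^2 x / t + c5 (x.g)^2 x / t^2 + c6 w |g|^2 x,
where g and H are the gradient and the Hessian of a function on a space of
dimension n, t = |x|^2, L = tr H, w = t^(-(b+1)/2), and the remaining letters
are the scalar invariants G = |g|^2, S = |H|^2, Y = |H x|^2, C = <g, H x>,
X1 = x.g, X2 = <x, H x>. The first two coefficients are forced: with them the
second-order part of L^2 minus this divergence is a sum of squares in which the
tangential Hessian only enters through its trace-free part. The third then
removes the products of X1 with the tangential trace. *)
Definition flux_div (n b c4 c5 c6 t w L G S Y C X1 X2 : R) :=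
  (n - 1) / (n - 2) * (L ^+ 2 - S)
  - 2 / (n - 2) * (- 2 * X1 * (L * t - X2) / t ^+ 2
                   + (X1 * L - C + X2 * L - Y + (n - 1) * X1 * L) / t)
  + 2 * (- 2 * X1 ^+ 2 / t ^+ 2 + (G + C + X1 * L) / t)
  + c4 * (((n - 2) * G + 2 * C) / t)
  + c5 * (((n - 2) * X1 ^+ 2 + 2 * X1 * X2) / t ^+ 2)
  + c6 * (w * ((n - (b + 1)) * G + 2 * C)).

Section scalar.
Variables (n b t w L G S Y C X1 X2 : R).
Hypotheses (n5 : 5 <= n) (t0 : 0 < t).
Hypothesis hTF :
  (L - X2 / t) ^+ 2 <= (n - 1) * (S - 2 * Y / t + X2 ^+ 2 / t ^+ 2).
Hypothesis hq : forall c, 0 <= Y - X2 ^+ 2 / t + 2 * c * (C - X1 * X2 / t)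
                               + c ^+ 2 * (G - X1 ^+ 2 / t).
Hypothesis hT : 0 <= G - X1 ^+ 2 / t.

Let t0' : 0 <= t. Proof. exact: ltW. Qed.
Let tN0 : t != 0. Proof. by rewrite gt_eqF. Qed.
Let n20 : 0 <= n - 2. Proof. by move: n5 => ?; lra. Qed.
Let n2N0 : n - 2 != 0. Proof. by move: n5 => ?; apply/eqP => ?; lra. Qed.

(** The remainder left by the divergence identity. In polar notation its terms are
a square in the radial derivatives, twice the square of the length of the
tangential part of (H x + c g) / r, the trace-free part of the tangential
Hessian, and a multiple of the tangential gradient. The last one is where the
dimension must be at least 5. *)
Let sum_of_squares_ge0 (p c : R) : 0 <= p ^+ 2
   + 2 / t * (Y - X2 ^+ 2 / t + 2 * c * (C - X1 * X2 / t)
                  + c ^+ 2 * (G - X1 ^+ 2 / t))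
   + ((n - 1) * (S - 2 * Y / t + X2 ^+ 2 / t ^+ 2) - (L - X2 / t) ^+ 2)
       / (n - 2)
   + ((w * t - 2) ^+ 2 / 2 + (n - 5)) / t * (G - X1 ^+ 2 / t).
Proof.
apply: addr_ge0; [apply: addr_ge0; [apply: addr_ge0|]|].
- exact: sqr_ge0.
- by apply: mulr_ge0; [apply: divr_ge0|exact: hq].
- by apply: divr_ge0 => //; rewrite subr_ge0.
- apply: mulr_ge0 => //; apply: divr_ge0 => //.
  by rewrite addr_ge0// ?divr_ge0 ?sqr_ge0// subr_ge0.
Qed.

(** The square in the radial derivatives is (p' - p/r + w r p)^2, where p is the
radial derivative: it vanishes on p = r exp(-phi) with phi' = w r. The
tangential shift w t / 2 is the one that leaves (w t - 2)^2 / 2 + n - 5 in front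
of the tangential gradient. *)
Lemma residual_ge0_linear :
  0 <= L ^+ 2 - ((n + 1 - b) * w - w ^+ 2 * t) * G
    - flux_div n b (- ((n - 1) / (n - 2))) (n / (n - 2)) (- 1)
        t w L G S Y C X1 X2.
Proof.
apply: le_trans (sum_of_squares_ge0 (X2 / t - X1 / t + w * X1) (w * t / 2)) _.
rewrite le_eqVlt; apply/orP; left; apply/eqP.
by rewrite /flux_div; field; rewrite tN0 n2N0.
Qed.

(** Here the radial square is (p' + (n-1) p/r - w r p)^2, built on the other
homogeneous solution p = r^(1-n) instead of p = r. The tangential shift is the
reflected one, and the coefficient of the tangential gradient is unchanged. *)
Lemma residual_ge0_newtonian :
  0 <= L ^+ 2 - ((n + b - 1) * w - w ^+ 2 * t) * G
    - flux_div n b (- ((n - 1) / (n - 2)) - 2 * (n - 2))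
        (n / (n - 2) + n - 4) 1 t w L G S Y C X1 X2.
Proof.
apply: le_trans (sum_of_squares_ge0 (X2 / t + (n - 1) * (X1 / t) - w * X1)
  (n - 2 - w * t / 2)) _.
rewrite le_eqVlt; apply/orP; left; apply/eqP.
by rewrite /flux_div; field; rewrite tN0 n2N0.
Qed.

End scalar.

Context (N : nat) (x g : 'I_N -> R) (H : 'I_N -> 'I_N -> R).
Let t := \sum_i x i ^+ 2.
Let h i := \sum_j H i j * x j.

(** The left-out square is the one of the component orthogonal to x of h + c g,
where h is the image of x under H. *)
Lemma radial_hessian_ge0 c : 0 < t -> 
  0 <= \sum_i h i ^+ 2 - (\sum_i x i * h i) ^+ 2 / t
    + 2 * c * (\sum_i g i * h i - (\sum_i x i * g i) * (\sum_i x i * h i) / t)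
    + c ^+ 2 * (\sum_i g i ^+ 2 - (\sum_i x i * g i) ^+ 2 / t).
Proof.
move=> t0.
set X1 := \sum_i x i * g i; set X2 := \sum_i x i * h i.
pose k := (X2 + c * X1) / t.
have : 0 <= \sum_i (h i + c * g i - k * x i) ^+ 2.
  by apply: sumr_ge0 => i _; exact: sqr_ge0.
have -> : \sum_i (h i + c * g i - k * x i) ^+ 2 =
  1 * \sum_i h i ^+ 2 + c ^+ 2 * \sum_i g i ^+ 2 + k ^+ 2 * t +
  2 * c * \sum_i g i * h i + (- 2 * k) * X2 + (- 2 * c * k) * X1.
  by rewrite !mulr_sumr -!big_split/=; apply: eq_bigr => i _; ring.
move=> h0; apply: (le_trans h0); rewrite le_eqVlt; apply/orP; left; apply/eqP.
by rewrite /k; field; rewrite gt_eqF.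
Qed.

Lemma radial_part_le : 0 < t ->
  0 <= \sum_i g i ^+ 2 - (\sum_i x i * g i) ^+ 2 / t.
Proof.
move=> t0.
set X1 := \sum_i x i * g i.
pose k := X1 / t.
have : 0 <= \sum_i (g i - k * x i) ^+ 2.
  by apply: sumr_ge0 => i _; exact: sqr_ge0.
have -> : \sum_i (g i - k * x i) ^+ 2 =
  1 * \sum_i g i ^+ 2 + k ^+ 2 * t + (- 2 * k) * X1.
  by rewrite !mulr_sumr -!big_split/=; apply: eq_bigr => i _; ring.
move=> h0; apply: (le_trans h0); rewrite le_eqVlt; apply/orP; left; apply/eqP.
by rewrite /k; field; rewrite gt_eqF.
Qed.

(** Cauchy-Schwarz between the compression of H to the hyperplane orthogonal to x
and the orthogonal projection on it, whose squared norm is N - 1. Integrated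
over spheres this is what encodes that the first nonzero eigenvalue of the
spherical Laplacian is N - 1. *)
Lemma hessian_trace_le : 0 < t -> 1 < N%:R :> R ->
  (forall i j, H i j = H j i) ->
  (\sum_i H i i - (\sum_i x i * h i) / t) ^+ 2 <= 
  (N%:R - 1) * (\sum_i \sum_j H i j ^+ 2 - 2 * (\sum_i h i ^+ 2) / t
                 + (\sum_i x i * h i) ^+ 2 / t ^+ 2).
Proof.
move=> t0 N1 Hs.
set L := \sum_i H i i; set X2 := \sum_i x i * h i.
set Y := \sum_i h i ^+ 2; set S := \sum_i _.
(* k is the mean eigenvalue of the compression of H. The compression minus
   k times the projection is A - (v x^T + x v^T) with A, v as below, so that
   only three double sums are needed. *)
pose k := (L - X2 / t) / (N%:R - 1).
pose c := X2 / t ^+ 2 + k / t.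
pose v i := h i / t - c / 2 * x i.
have vv : \sum_i v i ^+ 2 = Y / t ^+ 2 - c * X2 / t + c ^+ 2 * t / 4.
  transitivity ((t ^+ 2)^-1 * Y + (- c / t) * X2 + (c ^+ 2 / 4) * t); last first.
    by field; rewrite gt_eqF.
  rewrite !mulr_sumr -!big_split/=; apply: eq_bigr => i _; rewrite /v.
  by field; rewrite gt_eqF.
have vx : \sum_i v i * x i = X2 / t - c * t / 2.
  transitivity (t^-1 * X2 + (- c / 2) * t); last by field; rewrite gt_eqF.
  rewrite !mulr_sumr -!big_split/=; apply: eq_bigr => i _; rewrite /v.
  by field; rewrite gt_eqF.
have vh : \sum_i v i * h i = Y / t - c * X2 / 2.
  transitivity (t^-1 * Y + (- c / 2) * X2); last by field; rewrite gt_eqF.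
  rewrite !mulr_sumr -!big_split/=; apply: eq_bigr => i _; rewrite /v.
  by field; rewrite gt_eqF.
pose A i j := H i j - k * (i == j)%:R.
have Ax i : \sum_j A i j * x j = h i - k * x i.
  rewrite /A; under eq_bigr do rewrite mulrBl.
  rewrite sumrB; congr (_ - _).
  rewrite (bigD1 i)//= eqxx mulr1 big1 ?addr0// => j ji.
  by rewrite eq_sym (negbTE ji) mulr0 mul0r.
have As i j : A i j = A j i by rewrite /A Hs eq_sym.
have AA : \sum_i \sum_j A i j ^+ 2 = S - 2 * k * L + k ^+ 2 * N%:R.
  have -> : N%:R = \sum_(i < N) (1 : R).
    by rewrite sumr_const card_ord.
  transitivity (1 * S + (- 2 * k) * L + k ^+ 2 * \sum_(i < N) (1 : R)); last by ring.
  rewrite !mulr_sumr -!big_split/=; apply: eq_bigr => i _.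
  rewrite (bigD1 i)//= [in RHS](bigD1 i)//= /A eqxx mulr1n.
  rewrite (eq_bigr (fun j => H i j ^+ 2)); first by ring.
  by move=> j ji; rewrite eq_sym (negbTE ji) mulr0 subr0.
have AB : \sum_i \sum_j A i j * (v i * x j + x i * v j) = 
    2 * (Y / t - c * X2 / 2 - k * (X2 / t - c * t / 2)).
  transitivity (\sum_i \sum_j A i j * (v i * x j) +
                \sum_i \sum_j A i j * (x i * v j)).
    rewrite -big_split/=; apply: eq_bigr => i _; rewrite -big_split/=.
    by apply: eq_bigr => j _; rewrite mulrDr.
  rewrite [X in _ + X]exchange_big/=.
  rewrite [X in _ + X](_ : _ = \sum_i \sum_j A i j * (v i * x j)); last first.
    by apply: eq_bigr => i _; apply: eq_bigr => j _; rewrite As (mulrC (x _)).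
  have -> : \sum_i \sum_j A i j * (v i * x j) = 
      \sum_i v i * h i + (- k) * \sum_i v i * x i.
    rewrite mulr_sumr -big_split/=; apply: eq_bigr => i _.
    transitivity (v i * (\sum_j A i j * x j)); last by rewrite Ax; ring.
    by rewrite mulr_sumr; apply: eq_bigr => j _; ring.
  by rewrite vh vx; ring.
have BB : \sum_i \sum_j (v i * x j + x i * v j) ^+ 2 = 
    2 * (Y / t ^+ 2 - c * X2 / t + c ^+ 2 * t / 4) * t
    + 2 * (X2 / t - c * t / 2) ^+ 2.
  rewrite -vv -vx.
  set vt := \sum_i v i ^+ 2; set vxt := \sum_i v i * x i.
  transitivity (\sum_i (t * v i ^+ 2 + vt * x i ^+ 2 + 2 * vxt * (v i * x i))).
    apply: eq_bigr => i _.
    transitivity (v i ^+ 2 * t + x i ^+ 2 * vt + 2 * (v i * x i) * vxt);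
      last by ring.
    by rewrite !mulr_sumr -!big_split/=; apply: eq_bigr => j _; ring.
  by rewrite !big_split/= -!mulr_sumr -/vxt -/vt -/t; ring.
have : 0 <= \sum_i \sum_j (A i j + (-1) * (v i * x j + x i * v j)) ^+ 2.
  by apply: sumr_ge0 => i _; apply: sumr_ge0 => j _; exact: sqr_ge0.
have -> : \sum_i \sum_j (A i j + (-1) * (v i * x j + x i * v j)) ^+ 2 =
  1 * (\sum_i \sum_j A i j ^+ 2) + 
  (-2) * (\sum_i \sum_j A i j * (v i * x j + x i * v j)) +
  1 * \sum_i \sum_j (v i * x j + x i * v j) ^+ 2.
  rewrite !mulr_sumr -!big_split/=; apply: eq_bigr => i _.
  by rewrite !mulr_sumr -!big_split/=; apply: eq_bigr => j _; ring.
rewrite AA AB BB.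
rewrite [X in 0 <= X](_ : _ = S - 2 * Y / t + X2 ^+ 2 / t ^+ 2 - 
    (L - X2 / t) ^+ 2 / (N%:R - 1)); last first.
  rewrite /c /k; move: (N%:R) N1 => n N1; field.
  by rewrite (gt_eqF t0) andbT; apply/eqP => ?; lra.
rewrite subr_ge0 ler_pdivrMr; last lra.
by rewrite [_ * (N%:R - 1)]mulrC.
Qed.

End pointwise.

(** * Functions with continuous partial derivatives *)

Section grad.
Context (R : realType) (N : nat).
Implicit Types (f g : 'rV[R]_N -> R) (x : 'rV[R]_N).

(** A pointwise gradient is carried along with the function because the
differentiation rules below then compute the divergence of a composite field by
unification. *)
Definition C1grad f (df : 'I_N -> 'rV[R]_N -> R) :=
  [/\ continuous f, forall i, continuous (df i) &
      forall i x, is_derive x (delta_mx 0 i) f (df i x)].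

Lemma C1grad_ext f f' df df' : (forall x, f x = f' x) ->
  (forall i x, df i x = df' i x) -> C1grad f df -> C1grad f' df'.
Proof.
move=> /funext <- e; have <- : df = df' by apply/funext => i; exact/funext.
by [].
Qed.

Lemma continuous_add f g : continuous f -> continuous g ->
  continuous (fun x => f x + g x).
Proof. by move=> cf cg x; exact: (continuousD (cf x) (cg x)). Qed.

Lemma continuous_sub f g : continuous f -> continuous g ->
  continuous (fun x => f x - g x).
Proof. by move=> cf cg x; exact: (continuousB (cf x) (cg x)). Qed.

Lemma continuous_mul f g : continuous f -> continuous g ->
  continuous (fun x => f x * g x).
Proof. by move=> cf cg x; exact: (continuousM (cf x) (cg x)). Qed.

Lemma C1gradD f df g dg : C1grad f df -> C1grad g dg ->
  C1grad (fun x => f x + g x) (fun i x => df i x + dg i x).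
Proof.
move=> [cf cdf Df] [cg cdg Dg]; split.
- exact: continuous_add.
- by move=> i; apply: continuous_add.
- by move=> i x; apply: is_deriveD.
Qed.

Lemma C1gradB f df g dg : C1grad f df -> C1grad g dg ->
  C1grad (fun x => f x - g x) (fun i x => df i x - dg i x).
Proof.
move=> [cf cdf Df] [cg cdg Dg]; split.
- exact: continuous_sub.
- by move=> i; apply: continuous_sub.
- by move=> i x; apply: is_deriveB.
Qed.

Lemma C1gradM f df g dg : C1grad f df -> C1grad g dg ->
  C1grad (fun x => f x * g x) (fun i x => df i x * g x + f x * dg i x).
Proof.
move=> [cf cdf Df] [cg cdg Dg]; split.
- exact: continuous_mul.
- by move=> i; apply: continuous_add; apply: continuous_mul.
- move=> i x; have h := @is_deriveM _ _ f g x _ _ _ (Df i x) (Dg i x).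
  by apply: (is_derive_eq h); rewrite addrC mulrC.
Qed.

Lemma C1grad_cst c : C1grad (fun=> c) (fun _ _ => 0).
Proof.
by split=> [|i|i x]; [exact: cst_continuous|exact: cst_continuous|exact: is_derive_cst].
Qed.

Lemma C1grad_sum n (F : 'I_n -> _ -> R) dF : (forall k, C1grad (F k) (dF k)) ->
  C1grad (fun x => \sum_k F k x) (fun i x => \sum_k dF k i x).
Proof.
elim: n F dF => [|n IH] F dF h.
  apply: C1grad_ext (C1grad_cst 0) => *; by rewrite big_ord0.
apply: (C1grad_ext _ _ (C1gradD (h ord0)
  (IH _ _ (fun k => h (lift ord0 k))))) => [x|i x]; by rewrite big_ord_recl.
Qed.

Lemma C1grad_coord j : C1grad (fun x => x 0 j) (fun i _ => (i == j)%:R).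
Proof.
split=> [|i|i x]; [exact: coord_continuous|exact: cst_continuous|].
have h : (fun h : R => h^-1 *: (((fun x => x 0 j) \o shift x)
    (h *: delta_mx 0 i) - x 0 j)) @ 0^' --> ((i == j)%:R : R).
  apply: cvg_near_cst; near=> h.
  rewrite /= !mxE eqxx/= addrK eq_sym /GRing.scale/= mulrA mulVf ?mul1r//.
  by near: h; exact: nbhs_dnbhs_neq.
split; first by apply/cvg_ex; exists ((i == j)%:R).
exact: cvg_lim h.
Unshelve. all: by end_near. Qed.

Lemma smooth_partial f i : smooth f -> smooth (partial i f).
Proof. by move=> sf s; have := sf (rcons s i); rewrite foldr_rcons. Qed.

Lemma smooth_C1grad f : smooth f -> C1grad f (fun i => partial i f).
Proof.
move=> sf; have [cf df] := sf [::]; split.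
- exact: cf.
- by move=> i; have [] := sf [:: i].
- by move=> i x; apply: DeriveDef; [exact: df|].
Qed.

(** Directional differentiation at a point is differentiation on the line through
it, which is how one-variable calculus applies. *)
Lemma is_derive_slice f (v x : 'rV[R]_N) (s : R) (df : R) :
  is_derive (x + s *: v) v f df <->
  is_derive s 1 (fun s : R => f (x + s *: v)) df.
Proof.
have E : (fun h : R => h^-1 *: ((f \o shift (x + s *: v)) (h *: v) -
    f (x + s *: v))) = (fun h : R => h^-1 *: (((fun s => f (x + s *: v)) \o shift s)
    (h *: 1) - f (x + s *: v))).
  apply/funext => h /=; congr (_ *: (f _ - _)).
  by rewrite [h *: 1]mulr1 scalerDl addrCA addrA.
have E1 : derivable f (x + s *: v) v =
    derivable (fun s : R => f (x + s *: v)) s 1.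
  by rewrite /derivable E.
have E2 : 'D_v f (x + s *: v) = 'D_1 (fun s : R => f (x + s *: v)) s.
  by rewrite /derive E.
split=> -[h1 h2]; split.
- by rewrite -E1.
- by rewrite -E2.
- by rewrite E1.
- by rewrite E2.
Qed.

Lemma continuous_slice f (v x : 'rV[R]_N) : continuous f ->
  continuous (fun s : R => f (x + s *: v)).
Proof.
move=> cf s; apply: (@continuous_comp _ _ _ (fun s : R => x + s *: v) f).
  have h : {for s, continuous (cst x + ( *:%R^~ v : R -> 'rV[R]_N))}.
    apply: continuousD; first exact: cst_continuous.
    exact: scalel_continuous.
  exact: h.
exact: cf.
Qed.

Lemma MVT_slice f (df : 'rV[R]_N -> R) (v x : 'rV[R]_N) (h : R) : 0 < h ->
  (forall y, is_derive y v f (df y)) ->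
  exists2 s, 0 < s < h & f (x + h *: v) - f x = h * df (x + s *: v).
Proof.
move=> h0 Df.
have D (s : R) : is_derive s 1 (fun s => f (x + s *: v)) (df (x + s *: v)).
  exact/is_derive_slice.
have [|c] := @MVT R (fun s => f (x + s *: v)) (fun s => df (x + s *: v)) 0 h h0
  (fun s _ => D s).
  apply: derivable_within_continuous => s _.
  by apply: ex_derive; exact: D.
by rewrite in_itv/= scale0r addr0 subr0 mulrC => cI ->; exists c.
Qed.

(** Schwarz's theorem. Smoothness is stated through iterated coordinate
derivatives, so the symmetry of the Hessian has to be derived: by two mean value
steps the second difference over a square of side d is d^2 times a mixed
derivative, in either order, at some point of the square. *)
Lemma partial_sym f (i j : 'I_N) x : smooth f ->
  partial i (partial j f) x = partial j (partial i f) x.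
Proof.
move=> sf.
have key (k l : 'I_N) (e : R) : 0 < e -> exists s t,
   [/\ 0 < s < e, 0 < t < e &
   f (x + e *: 'e_k + e *: 'e_l) - f (x + e *: 'e_k) - f (x + e *: 'e_l) + f x =
   e * e * partial l (partial k f) (x + s *: 'e_k + t *: 'e_l)].
  move=> e0.
  pose g y := f (y + e *: 'e_l) - f y.
  have Dg y : is_derive y 'e_k g (partial k f (y + e *: 'e_l) - partial k f y).
    have [_ _ Df] := smooth_C1grad sf.
    have h : is_derive y 'e_k (f \o shift (e *: 'e_l))
        (partial k f (y + e *: 'e_l)).
      have [h1 h2] := Df k (y + e *: 'e_l).
      have E : (fun h : R => h^-1 *: (((f \o shift (e *: 'e_l)) \o shift y)
         (h *: 'e_k) - (f \o shift (e *: 'e_l)) y)) =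
       (fun h : R => h^-1 *: ((f \o shift (y + e *: 'e_l))
         (h *: 'e_k) - f (y + e *: 'e_l))).
        by apply/funext => h /=; rewrite addrA.
      by split; rewrite /derivable /derive E.
    exact: (is_deriveB (f := f \o shift (e *: 'e_l)) (g := f)).
  have [s sI gE] := MVT_slice x e0 Dg.
  have [_ _ Dkf] := smooth_C1grad (smooth_partial k sf).
  have [t tI fE] := MVT_slice (x + s *: 'e_k) e0 (Dkf l).
  exists s, t; split=> //; rewrite -mulrA -fE -gE /g.
  by rewrite opprB addrA; ring.
have cij : continuous (partial i (partial j f)).
  by have [_ /(_ i)] := smooth_C1grad (smooth_partial j sf).
have cji : continuous (partial j (partial i f)).
  by have [_ /(_ j)] := smooth_C1grad (smooth_partial i sf).
apply/eqP; rewrite -subr_eq0 -normr_le0; apply/ler_addgt0Pl => e e0.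
rewrite addr0.
have e2 : 0 < e / 2 by rewrite divr_gt0.
have /cvgrPdist_lt/(_ _ e2)/nbhs_ballP[d1 /= d10 H1] := cij x.
have /cvgrPdist_lt/(_ _ e2)/nbhs_ballP[d2 /= d20 H2] := cji x.
pose d := Num.min d1 d2 / 2.
have d0 : 0 < d by rewrite divr_gt0// lt_min d10.
have B (s t : R) (k l : 'I_N) r : 0 < s < d -> 0 < t < d -> Num.min d1 d2 <= r ->
   ball x r (x + s *: 'e_k + t *: 'e_l).
  move=> /andP[s0 sd] /andP[t0 td] dr.
  rewrite -ball_normE /ball_/= opprD addrA opprD addrA subrr add0r.
  rewrite -opprD normrN (le_lt_trans (ler_normD _ _))//.
  have ne (m : 'I_N) (w : R) : 0 < w -> `|w *: 'e_m : 'rV[R]_N| <= w.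
    move=> w0; rewrite mx_normZ gtr0_norm// ler_piMr ?(ltW w0)//.
    rewrite [leLHS](_ : _ = mx_norm ('e_m : 'rV[R]_N))// mx_normrE; apply/bigmax_leP; split=> // -[a b] _ /=.
    by rewrite mxE; case: (_ && _); rewrite ?normr1 ?normr0.
  rewrite (le_lt_trans (lerD (ne k s s0) (ne l t t0)))//.
  apply: (lt_le_trans _ dr); rewrite [ltRHS](_ : _ = d + d); last first.
    by rewrite -splitr.
  exact: ltrD.
have [s [t [sI tI E1]]] := key j i d d0.
have [s' [t' [sI' tI' E2]]] := key i j d d0.
have E : partial i (partial j f) (x + s *: 'e_j + t *: 'e_i) =
   partial j (partial i f) (x + s' *: 'e_i + t' *: 'e_j).
  have dd : d * d != 0 by rewrite mulf_neq0// gt_eqF.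
  apply: (mulfI dd); apply: (etrans (esym E1)); apply: (etrans _ E2).
  by rewrite (addrAC x (d *: 'e_j)); congr (_ + _); exact: addrAC.
have A1 := H1 _ (B _ _ j i d1 sI tI (ltac:(by rewrite ge_min lexx))).
have A2 := H2 _ (B _ _ i j d2 sI' tI' (ltac:(by rewrite ge_min lexx orbT))).
rewrite /= in A1 A2; rewrite E in A1.
move: A1 A2; move: (partial i _ x) (partial j _ x) (partial j _ (_ + _)).
move=> a b P A1 A2; rewrite (_ : a - b = (a - P) - (b - P)); last by ring.
rewrite (splitr e); apply: (le_trans (ler_normB _ _)).
exact: (lerD (ltW A1) (ltW A2)).
Qed.

End grad.

(** * Divergence identities with a radial weight *)

Section divergence_fields.
Context (R : realType) (N : nat).
Implicit Types (f g D : 'rV[R]_N -> R) (x : 'rV[R]_N).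

(** The field is quantified away so that linear combinations of the identities below,
whose integrals all vanish, can be formed without naming their fields. *)
Definition is_divergence D := exists (F : 'I_N -> 'rV[R]_N -> R) dF,
  [/\ forall i, C1grad (F i) (dF i),
      exists M : R, forall i x, M < `|x| -> F i x = 0 &
      forall x, D x = \sum_i dF i i x].

Lemma is_divergenceD D E : is_divergence D -> is_divergence E ->
  is_divergence (fun x => D x + E x).
Proof.
move=> [F [dF [cF [M FM] DE]]] [F' [dF' [cF' [M' FM'] DE']]].
exists (fun i x => F i x + F' i x), (fun i j x => dF i j x + dF' i j x); split.
- by move=> i; exact: C1gradD.
- exists (Num.max M M') => i x; rewrite gt_max => /andP[xM xM'].
  by rewrite FM// FM'// addr0.
- by move=> x; rewrite DE DE' big_split.
Qed.

Lemma is_divergenceZ c D : is_divergence D -> is_divergence (fun x => c * D x).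
Proof.
move=> [F [dF [cF [M FM] DE]]].
exists (fun i x => c * F i x), (fun i j x => c * dF i j x); split.
- move=> i; apply: C1grad_ext (C1gradM (C1grad_cst N c) (cF i)) => //= *.
  by rewrite mul0r add0r.
- by exists M => i x xM; rewrite FM// mulr0.
- by move=> x; rewrite DE mulr_sumr.
Qed.

Section fields.
Variable u : 'rV[R]_N -> R.
Hypothesis su : smooth u.

Definition sqn x := \sum_i x 0 i ^+ 2.
Definition du i x := partial i u x.
Definition ddu i j x := partial i (partial j u) x.
Definition dddu i j k x := partial i (partial j (partial k u)) x.
Definition hessx i x := \sum_j ddu i j x * x 0 j.
Definition gradsq x := \sum_i du i x ^+ 2.
Definition hesssq x := \sum_i \sum_j ddu i j x ^+ 2.
Definition xgrad x := \sum_i x 0 i * du i x.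
Definition xhessx x := \sum_i x 0 i * hessx i x.
Definition ghessx x := \sum_i du i x * hessx i x.
Definition hesssqx x := \sum_i hessx i x ^+ 2.

Local Notation L := (laplacian u).

Lemma ddu_sym i j x : ddu i j x = ddu j i x.
Proof. exact: partial_sym. Qed.

(** Third derivatives enter the divergences of fields that contain the Hessian; this
symmetry makes them cancel. *)
Lemma dddu_sym i k x : dddu i i k x = dddu k i i x.
Proof.
rewrite /dddu (_ : partial i (partial k u) = partial k (partial i u)).
  by apply: partial_sym; exact: smooth_partial.
by apply/funext => y; exact: partial_sym.
Qed.

Lemma C1_du j : C1grad (du j) (fun i => ddu i j).
Proof. by apply: smooth_C1grad; exact: smooth_partial. Qed.

Lemma C1_ddu j k : C1grad (ddu j k) (fun i => dddu i j k).
Proof. by apply: smooth_C1grad; apply: smooth_partial; exact: smooth_partial. Qed.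

Lemma C1_lap : C1grad L (fun i x => \sum_k dddu i k k x).
Proof. by apply: C1grad_sum => k; exact: C1_ddu. Qed.

Lemma C1_gradsq : C1grad gradsq (fun i x => 2 * \sum_k ddu i k x * du k x).
Proof.
apply: (C1grad_ext _ _ (C1grad_sum (fun k => C1gradM (C1_du k) (C1_du k)))).
  by move=> x; apply: eq_bigr => k _; rewrite expr2.
by move=> i x; rewrite mulr_sumr; apply: eq_bigr => k _; ring.
Qed.

Lemma lapE x : L x = \sum_i ddu i i x. Proof. by []. Qed.

Lemma sum_delta i (a : 'I_N -> R) : \sum_j (i == j)%:R * a j = a i.
Proof.
rewrite (bigD1 i)//= eqxx mul1r big1 ?addr0// => j ji.
by rewrite eq_sym (negbTE ji) mul0r.
Qed.

Lemma C1_xgrad : C1grad xgrad (fun i x => du i x + hessx i x).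
Proof.
apply: (C1grad_ext _ _ (C1grad_sum (fun k => C1gradM (C1grad_coord R k) (C1_du k)))) => //.
move=> i x; rewrite big_split/= sum_delta; congr (_ + _).
by apply: eq_bigr => k _; rewrite mulrC.
Qed.

Lemma C1_hessx j : C1grad (hessx j) (fun i x => \sum_k dddu i j k x * x 0 k + ddu j i x).
Proof.
apply: (C1grad_ext _ _ (C1grad_sum (fun k => C1gradM (C1_ddu j k) (C1grad_coord R k)))) => //.
move=> i x; rewrite big_split/=; congr (_ + _).
by rewrite -[RHS](sum_delta i (fun k => ddu j k x)); apply: eq_bigr => k _; rewrite mulrC.
Qed.

Lemma sum_ddu_du x : \sum_i x 0 i * (\sum_k ddu i k x * du k x) = ghessx x.
Proof.
under eq_bigr do rewrite mulr_sumr.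
rewrite exchange_big/=; apply: eq_bigr => i _.
by rewrite mulr_sumr; apply: eq_bigr => k _; rewrite ddu_sym; ring.
Qed.

Hypothesis u_supp : exists M : R, forall i x, M < `|x| -> du i x = 0.

Lemma grad_vanish x : (forall i, du i x = 0) -> xgrad x = 0 /\ gradsq x = 0.
Proof. by move=> h; split; apply: big1 => i _; rewrite h ?mulr0 ?expr0n. Qed.

(** The weight eta is radial: its gradient is eta1 times the position vector. *)
Variables (eta eta1 : 'rV[R]_N -> R).
Hypothesis Ceta : C1grad eta (fun i x => eta1 x * x 0 i).

(** Divergence of eta |grad u|^2 x. *)
Lemma div_radial_gradsq : is_divergence (fun x =>
  sqn x * eta1 x * gradsq x + eta x * (N%:R * gradsq x + 2 * ghessx x)).
Proof.
have [M HM] := u_supp.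
eexists; eexists; split.
- move=> i; exact: (C1gradM Ceta (C1gradM C1_gradsq (C1grad_coord R i))).
- exists M => i x xM; have [_ ->] := grad_vanish (fun i => HM i x xM).
  by rewrite mul0r mulr0.
- move=> x /=.
  transitivity (eta1 x * gradsq x * sqn x +
    2 * eta x * ghessx x + eta x * gradsq x * \sum_(i < N) 1).
    by rewrite sumr_const card_ord; ring.
  rewrite -sum_ddu_du /sqn; move: (gradsq x) => g.
  rewrite !mulr_sumr -!big_split/=; apply: eq_bigr => i _.
  by rewrite eqxx mulr1n; ring.
Qed.

(** Divergence of eta (x.grad u)^2 x. *)
Lemma div_radial_xgradsq : is_divergence (fun x =>
  sqn x * eta1 x * xgrad x ^+ 2 +
  eta x * (N%:R * xgrad x ^+ 2 + 2 * xgrad x * (xgrad x + xhessx x))).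
Proof.
have [M HM] := u_supp.
eexists; eexists; split.
- move=> i; exact: (C1gradM Ceta (C1gradM (C1gradM C1_xgrad C1_xgrad) (C1grad_coord R i))).
- exists M => i x xM; have [-> _] := grad_vanish (fun i => HM i x xM).
  by rewrite mul0r mul0r mulr0.
- move=> x /=.
  transitivity (eta1 x * xgrad x ^+ 2 * sqn x +
    2 * eta x * xgrad x * xgrad x + 2 * eta x * xgrad x * xhessx x +
       eta x * xgrad x ^+ 2 * \sum_(i < N) 1).
    by rewrite sumr_const card_ord; ring.
  rewrite [X in _ + _ * X + _ + _]/xgrad /sqn /xhessx; move: (xgrad x) => g.
  rewrite !mulr_sumr -!big_split/=; apply: eq_bigr => i _.
  by rewrite eqxx mulr1n; ring.
Qed.

(** Divergence of eta (x.grad u) grad u. *)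
Lemma div_xgrad_grad : is_divergence (fun x =>
  eta1 x * xgrad x ^+ 2 + eta x * (gradsq x + ghessx x + xgrad x * L x)).
Proof.
have [M HM] := u_supp.
eexists; eexists; split.
- move=> i; exact: (C1gradM Ceta (C1gradM C1_xgrad (C1_du i))).
- exists M => i x xM; have [-> _] := grad_vanish (fun i => HM i x xM).
  by rewrite mul0r mulr0.
- move=> x /=.
  transitivity (eta1 x * xgrad x * xgrad x +
    eta x * gradsq x + eta x * ghessx x + eta x * xgrad x * L x).
    by ring.
  rewrite [X in _ * X + _ + _ + _]/xgrad [X in _ + _ * X + _ + _]/gradsq /ghessx
    [X in _ + _ + _ + _ * X]lapE.
  move: (xgrad x) (L x) => g l.
  rewrite !mulr_sumr -!big_split/=; apply: eq_bigr => i _.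
  by ring.
Qed.

(** Divergence of eta (lap u grad u - D2u grad u). Its integrand without eta is the
null Lagrangian (lap u)^2 - |D2u|^2: the third derivatives cancel. *)
Lemma div_lap_grad : is_divergence (fun x =>
  eta1 x * (L x * xgrad x - ghessx x) + eta x * (L x ^+ 2 - hesssq x)).
Proof.
have [M HM] := u_supp.
eexists; eexists; split.
- move=> i; exact: (C1gradM Ceta (C1gradB (C1gradM C1_lap (C1_du i))
    (C1grad_sum (fun k => C1gradM (C1_ddu i k) (C1_du k))))).
- exists M => i x xM; rewrite HM// mulr0 big1 ?subr0 ?mulr0// => k _.
  by rewrite HM// mulr0.
- move=> x /=.
  have E : \sum_i (\sum_k dddu i k k x) * du i x =
           \sum_i \sum_k dddu i i k x * du k x.
    rewrite [RHS]exchange_big/=; apply: eq_bigr => k _.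
    by rewrite mulr_suml; apply: eq_bigr => i _; rewrite -dddu_sym.
  transitivity (eta1 x * L x * xgrad x + (- eta1 x) * ghessx x +
    eta x * L x * L x + (- eta x) * hesssq x +
    eta x * (\sum_i (\sum_k dddu i k k x) * du i x) +
    (- eta x) * (\sum_i \sum_k dddu i i k x * du k x)).
    by rewrite E; ring.
  rewrite -sum_ddu_du [X in _ + _ * L x * X + _]lapE
     [X in _ * L x * X + _]/xgrad /hesssq; move: (L x) => l.
  rewrite !mulr_sumr -!big_split/=; apply: eq_bigr => i _.
  rewrite big_split/= /hesssq.
  rewrite [in RHS](_ : \sum_k ddu i k x * ddu i k x = \sum_j ddu i j x ^+ 2).
    have alg (a b m y g h k r p q : R) : a * m * (y * g) + - a * (y * k) +
        b * m * h + - b * r + b * (p * g) + - b * q =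
        a * y * (m * g - k) + b * (p * g + m * h - (q + r)) by ring.
    exact: alg.
  by apply: eq_bigr => j _; rewrite expr2.
Qed.

(** Divergence of eta (x.grad u) (lap u x - D2u x); again no third derivative
survives. *)
Lemma div_xgrad_lap : is_divergence (fun x =>
  eta1 x * xgrad x * (L x * sqn x - xhessx x) +
  eta x * (xgrad x * L x - ghessx x + xhessx x * L x - hesssqx x
           + (N%:R - 1) * xgrad x * L x)).
Proof.
have [M HM] := u_supp.
eexists; eexists; split.
- move=> i; exact: (C1gradM Ceta (C1gradM C1_xgrad
    (C1gradB (C1gradM C1_lap (C1grad_coord R i)) (C1_hessx i)))).
- exists M => i x xM; have [-> _] := grad_vanish (fun i => HM i x xM).
  by rewrite mul0r mulr0.
- move=> x /=.
  have E : \sum_i (\sum_k dddu i k k x) * x 0 i =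
           \sum_i \sum_k dddu i i k x * x 0 k.
    rewrite [RHS]exchange_big/=; apply: eq_bigr => k _.
    by rewrite mulr_suml; apply: eq_bigr => i _; rewrite -dddu_sym.
  transitivity (eta1 x * xgrad x * L x * sqn x + (- eta1 x * xgrad x) * xhessx x
    + eta x * L x * xgrad x + (- eta x) * ghessx x + eta x * L x * xhessx x
    + (- eta x) * hesssqx x
    + eta x * xgrad x * L x * (\sum_(i < N) 1) + (- eta x * xgrad x) * L x
    + eta x * xgrad x * (\sum_i (\sum_k dddu i k k x) * x 0 i) +
    (- eta x * xgrad x) * (\sum_i \sum_k dddu i i k x * x 0 k)).
    by rewrite E sumr_const card_ord; ring.
  rewrite [X in _ + _ * X + _ * ghessx x + _]/xgrad /sqn /xhessx /ghessx /hesssqx.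
  rewrite [X in _ + _ * X + _ * (\sum_i (\sum_k _) * _) + _]lapE.
  move: (xgrad x) (L x) => g l.
  rewrite !mulr_sumr -!big_split/=; apply: eq_bigr => i _.
  by rewrite eqxx mulr1n; ring.
Qed.

End fields.
End divergence_fields.

(** * Integration along coordinate lines *)

Section integral_derive.
Context (R : realType).

(** The fundamental theorem of calculus on a segment that contains the support. *)
Lemma integral_compact_derive (f df : R -> R) (M : R) :
  (forall s : R, is_derive s 1 f (df s)) -> continuous df ->
  (forall s, M < `|s| -> f s = 0) -> (forall s, M < `|s| -> df s = 0) ->
  (\int[lebesgue_measure]_s (df s)%:E = 0)%E.
Proof.
move=> Df cdf f0 df0.
pose a := `|M| + 1.
have a0 : 0 < a by rewrite ltr_pwDr.
have Ma : M < a by rewrite (le_lt_trans (ler_norm _))// ltrDl.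
have aa : - a < a by rewrite (lt_trans _ a0)// oppr_lt0.
have cf : continuous f.
  move=> s; apply/differentiable_continuous/derivable1_diffP.
  by apply: ex_derive; exact: Df.
transitivity (\int[lebesgue_measure]_(s in `[(- a)%R, a]) (df s)%:E)%E.
  rewrite [RHS]integral_mkcond; apply: eq_integral => s _.
  rewrite patchE; case: ifPn => //; rewrite notin_setE/= in_itv/= => /negP.
  rewrite -ler_norml -ltNge => h; congr (_%:E).
  by rewrite df0// (lt_trans Ma).
rewrite (continuous_FTC2 (F := f) aa).
- by rewrite !f0 ?subee// ?normrN ?gtr0_norm.
- by apply: continuous_subspaceT.
- split=> [s _| |].
  + by apply: ex_derive; exact: Df.
  + exact: cvg_at_right_filter (cf _).
  + exact: cvg_at_left_filter (cf _).
- move=> s _; rewrite derive1E; exact: derive_val.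
Qed.

End integral_derive.

Lemma measurable_tuple_box d (T : measurableType d) n (A : 'I_n -> set T) :
  (forall i, measurable (A i)) ->
  measurable [set t : n.-tuple T | forall i, A i (tnth t i)].
Proof.
move=> mA; rewrite (_ : mkset _ = \bigcap_i
     ((fun t : n.-tuple T => tnth t i) @^-1` A i)).
  apply: fin_bigcap_measurable => // i _.
  by rewrite -[X in measurable X]setTI; apply: measurable_tnth.
by apply/seteqP; split => t /= h i; [move=> _|]; exact: h.
Qed.

Section tuples.
Context (R : realType).
Local Notation T := (measurableTypeR R).

Definition set_coord n (t : n.-tuple T) (i : 'I_n) (s : R) : n.-tuple T :=
  [tuple if j == i then s else tnth t j | j < n].

Lemma set_coord_tcons0 n (s0 s : R) (t : n.-tuple T) :
  set_coord (tcons (s0, t)) ord0 s = tcons (s, t).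
Proof.
apply: eq_from_tnth => j; rewrite tnth_mktuple.
by have [k ->|->//] := unliftP ord0 j; rewrite /tcons !tnthS.
Qed.

Lemma set_coord_tconsS n (s0 s : R) (t : n.-tuple T) (i : 'I_n) :
  set_coord (tcons (s0, t)) (lift ord0 i) s = tcons (s0, set_coord t i s).
Proof.
apply: eq_from_tnth => j; rewrite tnth_mktuple.
have [k ->|->//] := unliftP ord0 j; rewrite /tcons !tnthS tnth_mktuple.
by rewrite (inj_eq lift_inj).
Qed.

Definition box n (M : R) : set (n.-tuple T) :=
  [set t | forall i, (`[- M, M]%classic : set T) (tnth t i)].

Lemma measurable_box n M : measurable (@box n M).
Proof. exact: (@measurable_tuple_box _ T n _ (fun=> measurable_itv _)). Qed.

Lemma box_finite n M : (lebesgueN R n (@box n M) < +oo)%E.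
Proof.
have -> : lebesgueN R n (@box n M) =
    (\prod_(i < n) lebesgue_measure (`[(- M)%R, M]%classic : set T))%E.
  exact: (@product_pow_box R _ T lebesgue_measure n (fun=> `[(- M)%R, M]%classic)
    (fun=> measurable_itv _)).
suff : (\prod_(i < n) lebesgue_measure (`[(- M)%R, M]%classic : set T))%E
  \is a fin_num by move=> /fin_numPlt/andP[].
elim/big_ind : _ => // [x y x1 y1|i _]; first exact: fin_numM.
by rewrite lebesgue_measure_itv/=; case: ifP => // _; rewrite -EFinD.
Qed.

(** Boundedness with support in a box, unlike continuity, is inherited by the
sections of a function, which suits the induction on the number of
coordinates below. *)
Lemma bounded_box_integrable n (h : n.-tuple T -> R) M K :
  measurable_fun setT h -> (forall t, `|h t| <= K) ->
  (forall t, ~ box M t -> h t = 0) ->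
  (lebesgueN R n).-integrable setT (EFin \o h).
Proof.
move=> mh hK h0.
have -> : EFin \o h = (EFin \o h) \_ (@box n M).
  apply/funext => t; rewrite patchE; case: ifPn => //.
  by rewrite notin_setE => /h0 /= ->.
apply/(integrable_mkcond _ _).1; first exact: measurable_box.
apply: measurable_bounded_integrable.
- exact: measurable_box.
- exact: box_finite.
- exact: measurable_funS mh.
- exists K; split; first by rewrite num_real.
  by move=> x /ltW Kx t _ /=; rewrite (le_trans (hK t)).
Qed.

Lemma integral_lebesgueNS n (h : n.+1.-tuple T -> R) :
  (lebesgueN R n.+1).-integrable setT (EFin \o h) ->
  measurable_fun setT h ->
  ((\int[lebesgueN R n.+1]_t (h t)%:E =
     \int[lebesgue_measure]_s \int[lebesgueN R n]_t (h (tcons (s, t)))%:E) /\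
  (\int[lebesgueN R n.+1]_t (h t)%:E =
     \int[lebesgueN R n]_t \int[lebesgue_measure]_s (h (tcons (s, t)))%:E))%E.
Proof.
move=> ih mh.
have mc : measurable_fun setT (@tcons T n) by exact: measurable_tcons.
have mhc : measurable_fun setT (h \o @tcons T n) by exact: measurableT_comp.
have ihc : (lebesgue_measure \x (lebesgueN R n))%E.-integrable setT
    ((EFin \o h) \o @tcons T n).
  apply/integrableP; split; first exact/measurable_EFinP.
  move/integrableP : ih => [_]; apply: le_lt_trans.
  rewrite [leRHS](ge0_integral_pushforward mc)//.
  by apply: measurableT_comp => //; exact/measurable_EFinP.
have E : (\int[lebesgueN R n.+1]_t (h t)%:E =
   \int[lebesgue_measure \x (lebesgueN R n)]_t ((EFin \o h) \o @tcons T n) t)%E.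
  rewrite [LHS](integral_pushforward mc) ?preimage_setT//.
  exact/measurable_EFinP.
by split; rewrite E; [rewrite -integral12_prod_meas1|rewrite -integral21_prod_meas1].
Qed.

(** Fubini, one coordinate at a time: either the i-th coordinate is the first one and
is integrated first, or the sections in the remaining coordinates fall under the
induction hypothesis. *)
Lemma integral_zero_slices n (h : n.-tuple T -> R) M K (i : 'I_n) :
  measurable_fun setT h -> (forall t, `|h t| <= K) ->
  (forall t, ~ box M t -> h t = 0) ->
  (forall t, \int[lebesgue_measure]_s (h (set_coord t i s))%:E = 0)%E ->
  (\int[lebesgueN R n]_t (h t)%:E = 0)%E.
Proof.
elim: n h i => [h []//|n IH h i mh hK h0 H].
have ih := bounded_box_integrable mh hK h0.
have [E1 E2] := integral_lebesgueNS ih mh.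
have [j ij|i0] := unliftP ord0 i; last first.
  rewrite E2; under eq_integral.
    move=> t _; under eq_integral do rewrite -(set_coord_tcons0 0) -i0.
    rewrite H; over.
  exact: integral0.
rewrite E1; under eq_integral.
  move=> s _; rewrite (IH (fun t => h (tcons (s, t))) j).
  - over.
  - have m1 : measurable_fun setT (@tcons T n \o pair s).
      by apply: measurableT_comp; [exact: measurable_tcons|exact: pair1_measurable].
    exact: (measurableT_comp mh m1).
  - by move=> t; exact: hK.
  - move=> t tM; apply: h0 => /= tM'; apply: tM => k.
    by have := tM' (lift ord0 k); rewrite /tcons tnthS.
  - by move=> t; under eq_integral do rewrite -set_coord_tconsS -ij; exact: H.
exact: integral0.
Qed.

End tuples.

(** * Integrals over the space *)

Section vec.
Context (R : realType) (N : nat).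
Local Notation T := (measurableTypeR R).
Implicit Types (f D : 'rV[R]_N -> R) (x : 'rV[R]_N) (t : N.-tuple T).
Local Notation vec := (@vec_of_tuple R N).

(** Points are rounded down to the grid of mesh 1/(k+1), so that a function read on
the grid takes countably many values on measurable pieces. *)
Definition discretize (k : nat) t : N.-tuple int :=
  [tuple Num.floor (tnth t i * k.+1%:R) | i < N].

Definition grid (k : nat) (z : N.-tuple int) : 'rV[R]_N :=
  \row_i ((tnth z i)%:~R / k.+1%:R).

Lemma measurable_fiber k z : measurable (discretize k @^-1` [set z]).
Proof.
rewrite (_ : _ @^-1` _ = [set t : N.-tuple T | forall i,
   (`[(tnth z i)%:~R / k.+1%:R, (tnth z i + 1)%:~R / k.+1%:R[%classic : set T) (tnth t i)]).
  exact: (@measurable_tuple_box _ T N _ (fun=> measurable_itv _)).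
apply/seteqP; split => t /=.
  move=> <- i; rewrite tnth_mktuple in_itv/= ler_pdivrMr// ltr_pdivlMr//.
  exact: floor_itv.
move=> h; apply: eq_from_tnth => i; rewrite tnth_mktuple.
apply: floor_def; have := h i.
by rewrite in_itv/= ler_pdivrMr// ltr_pdivlMr.
Qed.

Lemma measurable_grid f k :
  measurable_fun setT (fun t => f (grid k (discretize k t)) : T).
Proof.
move=> _ B mB; rewrite setTI.
rewrite (_ : _ @^-1` _ = \bigcup_z
    (if f (grid k z) \in B then discretize k @^-1` [set z] else set0)).
  apply: countable_bigcupT_measurable => // z.
  by case: ifP => _; [exact: measurable_fiber|exact: measurable0].
apply/seteqP; split => t /=.
  by move=> Bt; exists (discretize k t) => //; rewrite mem_set.
by move=> [z _]; case: ifPn => // /set_mem Bz /= ->.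
Qed.

Lemma grid_dist k t : `|vec t - grid k (discretize k t)| <= k.+1%:R^-1.
Proof.
rewrite [leLHS](_ : _ = mx_norm (vec t - grid k (discretize k t)))// mx_normrE.
apply/bigmax_leP; split=> // -[i j] _ /=.
rewrite !mxE tnth_mktuple; set a := tnth t j.
have /andP[h1 h2] := floor_itv (a * k.+1%:R : R).
rewrite -[X in `|X - _|](mulfK (x := k.+1%:R : R))// -mulrBl normrM.
rewrite [X in _ * X]ger0_norm// ler_piMl// ger0_norm ?subr_ge0//.
by rewrite lerBlDl; apply: (le_trans (ltW h2)); rewrite rmorphD.
Qed.

(** The function is the pointwise limit of its values on finer and finer grids. At
the origin, which is a point of every grid, the approximations are constant. *)
Lemma measurable_continuous_off0 f : (forall x, x != 0 ->
  {for x, continuous f}) ->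
  measurable_fun setT (fun t => f (vec t) : T).
Proof.
move=> cf; apply: (measurable_fun_cvg (measurable_grid f)) => t _.
have [v0|v0] := eqVneq (vec t) 0.
  rewrite (_ : (fun k => _) = cst (f (vec t))); first exact: cvg_cst.
  apply/funext => k /=; rewrite v0; congr f.
  apply/rowP => i; rewrite !mxE tnth_mktuple.
  have : vec t 0 i = 0 by rewrite v0 mxE.
  by rewrite mxE => ->; rewrite mul0r floor0 mul0r.
apply: (cvg_comp (fun k => grid k (discretize k t)) f _ (cf _ v0)).
apply/cvgrPdist_le => e e0; near=> k.
apply: (le_trans (grid_dist k t)); apply: ltW.
near: k; exact: (near_infty_natSinv_lt (PosNum e0)).
Unshelve. all: by end_near. Qed.

Lemma measurable_vec f : continuous f ->
  measurable_fun setT (fun t => f (vec t) : T).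
Proof. by move=> cf; apply: measurable_continuous_off0 => x _; exact: cf. Qed.

Definition integrableRN f := (lebesgueN R N).-integrable setT (fun t => (f (vec t))%:E).

Lemma outside_box_norm t M : ~ @box R N M t -> M < `|vec t|.
Proof.
move=> h; rewrite ltNge; apply/negP => tM; apply: h => i /=.
rewrite in_itv/= -ler_norml (le_trans _ tM)//.
rewrite [leRHS](_ : _ = mx_norm (vec t))// mx_normrE.
by rewrite (le_trans _ (le_bigmax _ _ (0, i)))//= mxE.
Qed.

Lemma continuous_bounded_supp f M : continuous f ->
  (forall x, M < `|x| -> f x = 0) -> exists K, forall x, `|f x| <= K.
Proof.
move=> cf f0.
have flux_integrable : compact [set x : 'rV[R]_N | `|x| <= M].
  apply: bounded_closed_compact.
    by exists M; split; [exact: num_real|move=> y My x /= /le_trans; apply; exact: ltW].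
  rewrite (_ : mkset _ = (@Num.norm _ _) @^-1` [set s : R | s <= M]); last by [].
  by apply: closed_comp; [move=> x _; exact: norm_continuous|exact: closed_le].
have /compact_bounded[K [_ HK]] : compact (f @` [set x : 'rV[R]_N | `|x| <= M]).
  by apply: continuous_compact => //; exact: continuous_subspaceT.
exists (`|K| + 1) => x.
have [xM|xM] := leP `|x| M.
  by apply: (HK (`|K| + 1)); [rewrite ltr_pwDr// ler_norm|exists x].
by rewrite f0// normr0 addr_ge0.
Qed.

Lemma integrableRN_compact f M : continuous f -> (forall x, M < `|x| ->
  f x = 0) ->
  integrableRN f.
Proof.
move=> cf f0; have [K HK] := continuous_bounded_supp cf f0.
apply: (@bounded_box_integrable _ _ _ M K (measurable_vec cf)) => // t h.
by rewrite f0//; exact: outside_box_norm.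
Qed.

(** The complement of the closed ball of radius M is open. *)
Lemma partial_supp (F : 'rV[R]_N -> R) dF M i x : C1grad F dF ->
  (forall x, M < `|x| -> F x = 0) -> M < `|x| -> dF i x = 0.
Proof.
move=> [_ _ DF] F0 xM.
have D := DF i x.
rewrite -[LHS](@derive_val _ _ _ _ _ _ _ D).
rewrite (@near_eq_derive _ _ _ F (cst 0)) ?derive_cst//.
have /cvgr_gt/(_ _ xM) : `|y| @[y --> x] --> `|x| by exact: norm_continuous.
by apply: filterS => y; exact: F0.
Qed.

Lemma vec_set_coord t i (s : R) :
  vec (set_coord t i s) = (vec t - vec t 0 i *: 'e_i) + s *: 'e_i.
Proof.
apply/rowP => j; rewrite !mxE tnth_mktuple eqxx/=.
case: (eqVneq j i) => [->|ji]; rewrite ?mulr1 ?mulr0 ?subr0 ?addr0//.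
by rewrite subrr add0r.
Qed.

(** On each line in the i-th direction the integrand is the derivative of a compactly
supported function. *)
Lemma integral_partial_eq0 (F : 'rV[R]_N -> R) dF M i : C1grad F dF ->
  (forall x, M < `|x| -> F x = 0) ->
  integrableRN (dF i) /\ integralRN (dF i) = 0%E.
Proof.
move=> CF F0; have [cF cdF DF] := CF.
have dF0 x : M < `|x| -> dF i x = 0 by exact: partial_supp.
split; first exact: integrableRN_compact dF0.
have [K HK] := continuous_bounded_supp (cdF i) dF0.
apply: (@integral_zero_slices _ _ (fun t => dF i (vec t)) M K i) => //.
- exact: measurable_vec.
- by move=> t /outside_box_norm; exact: dF0.
move=> t.
set y := vec t - vec t 0 i *: 'e_i.
have big (s : R) : M < `|s| -> M < `|y + s *: 'e_i|.
  move=> sM; rewrite -vec_set_coord.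
  apply: outside_box_norm => /(_ i) /=; rewrite tnth_mktuple eqxx in_itv/= -ler_norml.
  by rewrite leNgt sM.
under eq_integral do rewrite vec_set_coord -/y.
apply: (@integral_compact_derive _ (fun s => F (y + s *: 'e_i)) _ M).
- by move=> s; apply/is_derive_slice; exact: DF.
- exact: continuous_slice.
- by move=> s /big; exact: F0.
- by move=> s /big; exact: dF0.
Qed.

Lemma integrableRND f g : integrableRN f -> integrableRN g ->
  integrableRN (fun x => f x + g x).
Proof. by move=> mf mg; exact: (integrableD measurableT mf mg). Qed.

Lemma integrableRNZ c f : integrableRN f -> integrableRN (fun x => c * f x).
Proof. by move=> mf; exact: (integrableZl measurableT c mf). Qed.

Lemma integralRND f g : integrableRN f -> integrableRN g ->
  integralRN (fun x => f x + g x) = (integralRN f + integralRN g)%E.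
Proof. by move=> mf mg; exact: (integralD measurableT mf mg). Qed.

(** The divergence theorem for compactly supported fields. *)
Lemma is_divergence_integral D : is_divergence D ->
  integrableRN D /\ integralRN D = 0%E.
Proof.
move=> [F [dF [CF [M F0] DE]]].
have -> : D = (fun x => \sum_i dF i i x) by apply/funext.
have : forall (r : seq 'I_N), integrableRN (fun x => \sum_(i <- r) dF i i x) /\
   integralRN (fun x => \sum_(i <- r) dF i i x) = 0%E.
  elim=> [|i r [IH1 IH2]].
    split.
      apply: (eq_integrable measurableT (cst 0%E)); last exact: integrable0.
      by move=> t _; rewrite big_nil.
    rewrite /integralRN; under eq_integral do rewrite big_nil.
    exact: integral0.
  have [I1 I2] := integral_partial_eq0 i (CF i) (F0 i).
  have E : (fun x => \sum_(j <- i :: r) dF j j x) =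
           (fun x => dF i i x + \sum_(j <- r) dF j j x).
    by apply/funext => x; rewrite big_cons.
  rewrite E; split; first exact: integrableRND.
  by rewrite integralRND// I2 IH2 adde0.
exact.
Qed.

Lemma le_integralRN f g : integrableRN f -> integrableRN g ->
  (forall x, f x <= g x) -> (integralRN f <= integralRN g)%E.
Proof.
move=> mf mg fg; apply: (le_integral measurableT mf mg) => t _.
by rewrite lee_fin.
Qed.

Lemma origin_null : (0 < N)%N ->
  (lebesgueN R N).-negligible [set t | vec t = 0].
Proof.
move=> N0; exists [set t | forall i, [set (0%R : T)] (tnth t i)]; split.
- exact: (@measurable_tuple_box _ T N _ (fun=> measurable_set1 _)).
- transitivity (\prod_(i < N) lebesgue_measure [set (0%R : T)])%E.
    exact: (@product_pow_box R _ T lebesgue_measure N (fun=> [set (0%R : T)])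
       (fun=> measurable_set1 _)).
  case: N N0 => // n _; rewrite big_ord_recl lebesgue_measure_set1 mul0e.
  by [].
- move=> t /= v0 i /=; have : vec t 0 i = 0 by rewrite v0 mxE.
  by rewrite mxE.
Qed.

End vec.

(** * Cutoff near the origin *)

Section cutoffs.
Context (R : realType).
Implicit Types (t e p : R).

(** As a function of t = |x|^2 this is the power t^(-p) times the cutoff
(1 - e/t)^2, which vanishes for t <= e. Multiplying the cutoff into the power
gives a function of class C1 on the whole line. *)
Definition cutoff p e t := Num.max 0 (t - e) ^+ 2 * t `^ (- p - 2).
Definition dcutoff p e t := 2 * Num.max 0 (t - e) * t `^ (- p - 2) +
  Num.max 0 (t - e) ^+ 2 * ((- p - 2) * t `^ (- p - 3)).

Lemma continuous_pos_part e : continuous (fun t => Num.max 0 (t - e)).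
Proof.
move=> t; apply: (@continuous_max _ _ (cst 0) (fun t => t - e)).
  exact: cst_continuous.
by apply: continuousB; [exact: cvg_id|exact: cst_continuous].
Qed.

(** At t = e the difference quotient in h is the positive part of h. *)
Lemma is_derive_pos_part_sqr e t :
  is_derive t 1 (fun t => Num.max 0 (t - e) ^+ 2) (2 * Num.max 0 (t - e)).
Proof.
have [te|te|te] := ltgtP t e.
- have h : \forall y \near t, cst 0 y = Num.max 0 (y - e) ^+ 2.
    have := lt_nbhsl te; apply: filterS => y /= ye.
    by rewrite max_l ?expr0n// subr_le0 ltW.
  apply: (near_eq_is_derive h).
  by rewrite max_l ?mulr0 ?subr_le0 ?(ltW te)//; exact: is_derive_cst.
- have h : \forall y \near t, (y - e) ^+ 2 = Num.max 0 (y - e) ^+ 2.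
    have := lt_nbhsr te; apply: filterS => y /= ye.
    by rewrite max_r// subr_ge0 ltW.
  apply: (near_eq_is_derive h).
  rewrite max_r ?subr_ge0 ?(ltW te)//.
  have H := @is_deriveX _ _ (shift (- e)) 2 t 1 1 (is_derive_shift t 1 (- e)).
  by apply: (is_derive_eq H); rewrite /GRing.scale/= mulr1.
- rewrite te subrr maxxx mulr0.
  have h : (fun h : R => h^-1 *: (((fun t => Num.max 0 (t - e) ^+ 2) \o shift e)
      (h *: 1) - Num.max 0 (e - e) ^+ 2)) @ 0^' --> (0 : R).
    have H : Num.max 0 h @[h --> (0 : R)] --> (0 : R).
      apply/cvgrPdist_le => d d0; near=> y.
      have yd : `|y| <= d by near: y; exact: (@nbhs0_le R R _ d0).
      rewrite sub0r normrN; apply: le_trans yd.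
      by rewrite ger0_norm ?le_max ?lexx// ge_max normr_ge0 ler_norm.
    have E : \forall h \near (0 : R)^', Num.max 0 h =
       h^-1 *: (((fun t => Num.max 0 (t - e) ^+ 2) \o shift e)
      (h *: 1) - Num.max 0 (e - e) ^+ 2).
      near=> h.
      have h0 : h != 0 by near: h; exact: nbhs_dnbhs_neq.
      rewrite /= addrK subrr maxxx expr0n subr0 [h *: 1]mulr1.
      rewrite /GRing.scale/=.
      have [h1|h1] := leP 0 h; last by rewrite expr0n mulr0.
      by rewrite expr2 mulrA mulVf ?mul1r.
    apply: (cvg_trans (near_eq_cvg E)); apply: cvg_within_filter.
    exact: H.
  split; first by apply/cvg_ex; exists 0.
  exact: cvg_lim h.
Unshelve. all: by end_near. Qed.

Lemma cutoff_near0 p e t : 0 < e -> t < e ->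
  (\forall y \near t, cst 0 y = cutoff p e y) /\
  (\forall y \near t, cst 0 y = dcutoff p e y).
Proof.
move=> e0 te; split; have := lt_nbhsl te; apply: filterS => y /= ye;
  by rewrite /cutoff /dcutoff max_l ?subr_le0 ?(ltW ye)// expr0n/= ?mulr0 !mul0r ?addr0.
Qed.

Lemma is_derive_cutoff p e t : 0 < e ->
  is_derive t 1 (cutoff p e) (dcutoff p e t).
Proof.
move=> e0; have [te|et] := ltP t e.
  have [h1 h2] := cutoff_near0 p e0 te.
  by apply: (near_eq_is_derive h1); rewrite -(nbhs_singleton h2); exact: is_derive_cst.
have t0 : 0 < t by exact: lt_le_trans et.
have h1 := is_derive_pos_part_sqr e t.
have h2 := is_derive1_powR (- p - 2) t0.
have := is_deriveM h1 h2; rewrite /cutoff => H.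
apply: (is_derive_eq H); rewrite /dcutoff /GRing.scale/=.
by rewrite (_ : - p - 2 - 1 = - p - 3); ring.
Qed.

Lemma continuous_powR_pos p t : 0 < t -> {for t, continuous (fun t => t `^ p)}.
Proof.
move=> t0; apply/differentiable_continuous/derivable1_diffP.
by apply: ex_derive; exact: is_derive1_powR.
Qed.

Lemma continuous_dcutoff p e : 0 < e -> continuous (dcutoff p e).
Proof.
move=> e0 t; have [te|et] := ltP t e.
  have [_ h2] := cutoff_near0 p e0 te.
  apply: (cvg_trans (near_eq_cvg h2)).
  rewrite -(nbhs_singleton h2); exact: cvg_cst.
have t0 : 0 < t by exact: lt_le_trans et.
have h1 := @continuous_pos_part e t.
apply: cvgD; apply: cvgM.
- by apply: cvgM => //; exact: cvg_cst.
- exact: continuous_powR_pos.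
- by rewrite expr2; apply: cvgM.
- apply: cvgM; [exact: cvg_cst|exact: continuous_powR_pos].
Qed.

Lemma powR_pred p t : 0 < t -> t `^ (p - 1) = t `^ p / t.
Proof.
move=> t0; rewrite powRB ?powRr1 ?(ltW t0)//.
by apply/implyP => _; rewrite gt_eqF.
Qed.

(** theta is the cutoff itself, and zeta is its derivative along the position vector,
the error made when the cutoff is differentiated. Both stay in [0, 1]; as e tends
to 0 they tend to 1 and to 0. *)
Definition theta e t := cutoff 0 e t.
Definition zeta e t := 2 * t * dcutoff 0 e t.

Lemma thetaE e t : 0 < t -> theta e t = (Num.max 0 (t - e) / t) ^+ 2.
Proof.
move=> t0; rewrite /theta /cutoff (_ : - 0 - 2 = 0 - 1 - 1); last by ring.
rewrite !powR_pred// powRr0; field; exact: lt0r_neq0.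
Qed.

Lemma zetaE e t : 0 < t -> zeta e t =
  4 * (Num.max 0 (t - e) / t) * (1 - Num.max 0 (t - e) / t).
Proof.
move=> t0; rewrite /zeta /dcutoff (_ : - 0 - 3 = 0 - 1 - 1 - 1); last by ring.
rewrite (_ : - 0 - 2 = 0 - 1 - 1); last by ring.
rewrite !powR_pred// powRr0; field; exact: lt0r_neq0.
Qed.

Lemma cutoffE p e t : 0 < t -> cutoff p e t = theta e t * t `^ (- p).
Proof.
move=> t0; rewrite thetaE// /cutoff (_ : - p - 2 = - p - 1 - 1); last by ring.
rewrite !powR_pred//; field; exact: lt0r_neq0.
Qed.

(** Twice the derivative in |x|^2 is the factor of the position vector in the
gradient of the weight. It splits into the derivative of the power, still
multiplied by theta, and the error term zeta. *)
Lemma dcutoffE p e t : 0 < t ->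
  2 * dcutoff p e t = (zeta e t - 2 * p * theta e t) * t `^ (- p) / t.
Proof.
move=> t0; rewrite thetaE// zetaE// /dcutoff.
rewrite (_ : - p - 3 = - p - 1 - 1 - 1); last by ring.
rewrite (_ : - p - 2 = - p - 1 - 1); last by ring.
rewrite !powR_pred//; field; exact: lt0r_neq0.
Qed.

Lemma cutoff0 p e t : 0 < e -> t <= 0 -> cutoff p e t = 0 /\ dcutoff p e t = 0.
Proof.
move=> e0 t0; have [h1 h2] := cutoff_near0 p e0 (le_lt_trans t0 e0).
by rewrite -(nbhs_singleton h1) -(nbhs_singleton h2).
Qed.

Lemma kappa_ge0_le1 e t : 0 < e -> 0 < t -> 0 <= Num.max 0 (t - e) / t <= 1.
Proof.
move=> e0 t0; rewrite divr_ge0 ?le_max ?lexx ?(ltW t0)//=.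
by rewrite ler_pdivrMr// mul1r ge_max (ltW t0)/= gerBl ltW.
Qed.

Lemma theta_itv e t : 0 < e -> 0 <= theta e t <= 1.
Proof.
move=> e0; have [t0|t0] := ltP 0 t; last first.
  by rewrite /theta (cutoff0 _ e0 t0).1 lexx ler01.
have /andP[k0 k1] := kappa_ge0_le1 e0 t0.
by rewrite thetaE// sqr_ge0/= expr_le1.
Qed.

Lemma zeta_itv e t : 0 < e -> 0 <= zeta e t <= 1.
Proof.
move=> e0; have [t0|t0] := ltP 0 t; last first.
  by rewrite /zeta (cutoff0 _ e0 t0).2 mulr0 lexx ler01.
have /andP[k0 k1] := kappa_ge0_le1 e0 t0.
rewrite zetaE//; set k := Num.max _ _ / t in k0 k1 *.
apply/andP; split; first by nra.
have := sqr_ge0 (1 - 2 * k); nra.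
Qed.

Lemma cvg_kappa t : 0 < t ->
  Num.max 0 (t - n.+1%:R^-1) / t @[n --> \oo] --> (1 : R).
Proof.
move=> t0.
have E : \forall n \near \oo, 1 - n.+1%:R^-1 / t =
    Num.max 0 (t - n.+1%:R^-1) / t.
  near=> n.
  have nt : n.+1%:R^-1 < t by near: n; exact: (near_infty_natSinv_lt (PosNum t0)).
  by rewrite max_r ?subr_ge0 ?(ltW nt)// mulrBl mulfV// gt_eqF.
apply: (cvg_trans (near_eq_cvg E)).
have H : (fun n : nat => 1 - n.+1%:R^-1 / t) @ \oo --> 1 - 0 / t.
  apply: cvgB; first exact: cvg_cst.
  by apply: cvgM; [exact: cvg_harmonic|exact: cvg_cst].
by move: H; rewrite mul0r subr0.
Unshelve. all: by end_near. Qed.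

Lemma cvg_theta t : 0 < t -> theta n.+1%:R^-1 t @[n --> \oo] --> (1 : R).
Proof.
move=> t0; have H := cvgM (cvg_kappa t0) (cvg_kappa t0).
have E : \forall n \near \oo, (Num.max 0 (t - n.+1%:R^-1) / t) *
    (Num.max 0 (t - n.+1%:R^-1) / t) = theta n.+1%:R^-1 t.
  by apply: nearW => n; rewrite thetaE// expr2.
by rewrite mulr1 in H; apply: (cvg_trans (near_eq_cvg E)); exact: H.
Qed.

Lemma cvg_zeta t : 0 < t -> zeta n.+1%:R^-1 t @[n --> \oo] --> (0 : R).
Proof.
move=> t0; have H : (fun n : nat => 4 * (Num.max 0 (t - n.+1%:R^-1) / t) *
    (1 - Num.max 0 (t - n.+1%:R^-1) / t)) @ \oo --> 4 * 1 * (1 - 1 : R).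
  apply: cvgM.
    by apply: cvgM; [exact: cvg_cst|exact: cvg_kappa].
  by apply: cvgB; [exact: cvg_cst|exact: cvg_kappa].
have E : \forall n \near \oo, 4 * (Num.max 0 (t - n.+1%:R^-1) / t) *
    (1 - Num.max 0 (t - n.+1%:R^-1) / t) = zeta n.+1%:R^-1 t.
  by apply: nearW => n; rewrite zetaE.
rewrite subrr mulr0 in H.
by apply: (cvg_trans (near_eq_cvg E)); exact: H.
Qed.

Lemma C1grad_comp N (k dk : R -> R) (f : 'rV[R]_N -> R) df :
  (forall t : R, is_derive t 1 k (dk t)) -> continuous dk -> C1grad f df ->
  C1grad (fun x => k (f x)) (fun i x => dk (f x) * df i x).
Proof.
move=> Dk cdk [cf cdf Df].
have ck : continuous k.
  move=> t; apply/differentiable_continuous/derivable1_diffP.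
  by apply: ex_derive; exact: Dk.
split.
- by move=> x; apply: (@continuous_comp _ _ _ f k); [exact: cf|exact: ck].
- move=> i; apply: continuous_mul; last exact: cdf.
  by move=> x; apply: (@continuous_comp _ _ _ f dk); [exact: cf|exact: cdk].
- move=> i x; set v := delta_mx 0 i.
  have Dx : is_derive (0 : R) 1 (fun s : R => f (x + s *: v)) (df i x).
    by apply/is_derive_slice; rewrite scale0r addr0; exact: Df.
  have Dkx : is_derive ((fun s : R => f (x + s *: v)) 0) 1 k (dk (f x)).
    by rewrite /= scale0r addr0; exact: Dk.
  have H : is_derive (x + (0 : R) *: v) v (fun x => k (f x)) (dk (f x) * df i x).
    by apply/is_derive_slice; exact: (is_derive1_comp Dkx Dx).
  by move: H; rewrite scale0r addr0.
Qed.

Lemma C1grad_sqn N : C1grad (@sqn R N) (fun i x => 2 * x 0 i).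
Proof.
apply: (C1grad_ext _ _ (C1grad_sum (fun k => C1gradM (C1grad_coord R k) (C1grad_coord R k)))).
  by move=> x; apply: eq_bigr => k _; rewrite expr2.
move=> i x; rewrite (bigD1 i)//= eqxx mulr1n big1 ?addr0 => [|k ki]; first by ring.
by rewrite eq_sym (negbTE ki) mul0r mulr0 addr0.
Qed.

Lemma C1grad_cutoff N p e : 0 < e ->
  C1grad (fun x : 'rV[R]_N => cutoff p e (sqn x))
    (fun i x => 2 * dcutoff p e (sqn x) * x 0 i).
Proof.
move=> e0; apply: (C1grad_ext _ _ (C1grad_comp (fun t => is_derive_cutoff p t e0)
  (continuous_dcutoff e0) (C1grad_sqn N))) => // i x.
by rewrite mulrCA mulrA.
Qed.

End cutoffs.

(** * Functions continuous away from the origin *)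

Section continuous_off0.
Context (R : realType) (N : nat).
Implicit Types (f g : 'rV[R]_N -> R) (x : 'rV[R]_N).
Local Notation T := (measurableTypeR R).
Local Notation vec := (@vec_of_tuple R N).

(** The weights are singular at the origin only; as the origin is a null set this
regularity suffices for integration. *)
Definition continuous_off0 f := forall x, x != 0 -> {for x, continuous f}.

Lemma continuous_off0_continuous f : continuous f -> continuous_off0 f.
Proof. by move=> cf x _; exact: cf. Qed.

Lemma continuous_off0D f g : continuous_off0 f -> continuous_off0 g ->
  continuous_off0 (fun x => f x + g x).
Proof. by move=> cf cg x x0; exact: (continuousD (cf x x0) (cg x x0)). Qed.

Lemma continuous_off0B f g : continuous_off0 f -> continuous_off0 g ->
  continuous_off0 (fun x => f x - g x).
Proof. by move=> cf cg x x0; exact: (continuousB (cf x x0) (cg x x0)). Qed.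

Lemma continuous_off0M f g : continuous_off0 f -> continuous_off0 g ->
  continuous_off0 (fun x => f x * g x).
Proof. by move=> cf cg x x0; exact: (continuousM (cf x x0) (cg x x0)). Qed.

Lemma continuous_off0_cst c : continuous_off0 (fun=> c).
Proof. by apply: continuous_off0_continuous; exact: cst_continuous. Qed.

Lemma sqn_gt0 x : (0 < sqn x) = (x != 0).
Proof.
have s0 : 0 <= sqn x by apply: sumr_ge0 => i _; exact: sqr_ge0.
rewrite lt_def s0 andbT; congr negb; apply/eqP/eqP => [h|->]; last first.
  by rewrite /sqn big1// => i _; rewrite mxE expr0n.
apply/rowP => i; rewrite mxE; apply/eqP.
rewrite -sqrf_eq0; move/eqP: h.
rewrite psumr_eq0 => [/allP/(_ i)|j _]; last exact: sqr_ge0.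
by rewrite mem_index_enum => /(_ isT).
Qed.

Lemma sqn0 : sqn (0 : 'rV[R]_N) = 0.
Proof. by apply/eqP; rewrite eq_le leNgt sqn_gt0 eqxx/= sumr_ge0// => i _; exact: sqr_ge0. Qed.

Lemma continuous_sqn : continuous (@sqn R N).
Proof. by have [] := C1grad_sqn R N. Qed.

Lemma continuous_off0V f : (forall x, x != 0 -> f x != 0) ->
  continuous_off0 f ->
  continuous_off0 (fun x => (f x)^-1).
Proof. by move=> f0 cf x x0; exact: (continuousV (f0 x x0) (cf x x0)). Qed.

Lemma continuous_off0_ext f g : (forall x, x != 0 -> f x = g x) ->
  continuous_off0 f -> continuous_off0 g.
Proof.
move=> fg cf x x0; suff : g y @[y --> x] --> g x by [].
rewrite -(fg x x0).
have E : \forall y \near x, f y = g y.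
  have nx : 0 < `|x| by rewrite normr_gt0.
  have /cvgr_gt/(_ _ nx) : `|y| @[y --> x] --> `|x| by exact: norm_continuous.
  by apply: filterS => y y0; apply: fg; rewrite -normr_gt0.
by apply: (cvg_trans (near_eq_cvg E)); exact: cf.
Qed.

Lemma continuous_off0_powR p : continuous_off0 (fun x => sqn x `^ p).
Proof.
move=> x x0; apply: (@continuous_comp _ _ _ (@sqn R N) (fun t => t `^ p)).
  exact: continuous_sqn.
by apply: continuous_powR_pos; rewrite sqn_gt0.
Qed.

Lemma integrableRN_dom f g : continuous_off0 f -> integrableRN g ->
  (forall x, `|f x| <= g x) -> integrableRN f.
Proof.
move=> cf ig fg; apply: (le_integrable measurableT _ _ ig).
  by apply/measurable_EFinP; exact: measurable_continuous_off0.
by move=> t _; rewrite /= lee_fin (le_trans (fg _))// ler_norm.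
Qed.

Lemma integrableRNB f g : integrableRN f -> integrableRN g ->
  integrableRN (fun x => f x - g x).
Proof. by move=> mf mg; exact: (integrableB measurableT mf mg). Qed.

Lemma integrableRN_norm f : integrableRN f -> integrableRN (fun x => `|f x|).
Proof.
move=> mf; have := integrable_abse mf.
by apply: eq_integrable => // t _.
Qed.

(** Inverses and powers of |x| take conventional values at the origin, which this
lemma allows to ignore. *)
Lemma integralRN_eq_off0 f g : (0 < N)%N -> continuous_off0 g ->
  (forall x, x != 0 -> f x = g x) -> integralRN f = integralRN g.
Proof.
move=> N0 cg fg; apply: ae_eq_integral => //.
- apply/measurable_EFinP; apply: measurable_continuous_off0.
  by apply: continuous_off0_ext cg => x x0; rewrite fg.
- by apply/measurable_EFinP; apply: measurable_continuous_off0.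
- apply: negligibleS (origin_null R N0) => t /= ne.
  by apply: contrapT => /eqP /fg e; apply: ne => _; rewrite e.
Qed.

End continuous_off0.

(** * The Hardy inequality for the gradient *)

Section test.
Context (R : realType) (N : nat) (u : 'rV[R]_N -> R).
Hypothesis hN : (5 <= N)%N.
Hypothesis tu : test_function u.
Implicit Types x : 'rV[R]_N.
Local Notation T := (measurableTypeR R).
Local Notation vec := (@vec_of_tuple R N).
Local Notation n := (N%:R : R).

Let su : smooth u. Proof. by case: tu. Qed.
Let n5 : 5 <= n. Proof. by rewrite (ler_nat _ 5). Qed.

Local Notation L := (laplacian u).
Local Notation G := (gradsq u).
Local Notation S := (hesssq u).
Local Notation Y := (hesssqx u).
Local Notation C := (ghessx u).
Local Notation X1 := (xgrad u).
Local Notation X2 := (xhessx u).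

Lemma test_supp : exists M, forall x, M < `|x| -> u x = 0.
Proof.
have [_ /compact_bounded[M [_ HM]]] := tu.
exists (M + 1) => x Mx; apply: contrapT => /eqP ux.
have : `|x| <= M + 1 by apply: HM; [rewrite ltrDl|exact: subset_closure].
by rewrite leNgt Mx.
Qed.

Lemma du_supp : exists M, forall i x, M < `|x| -> du u i x = 0.
Proof.
have [M HM] := test_supp; exists M => i x.
exact: (partial_supp i (smooth_C1grad su) HM).
Qed.

Lemma ddu_supp : exists M, forall i j x, M < `|x| -> ddu u i j x = 0.
Proof.
have [M HM] := du_supp; exists M => i j x.
exact: (partial_supp i (C1_du su j) (HM j)).
Qed.

Lemma continuous_sum m (F : 'I_m -> 'rV[R]_N ->
  R) : (forall k, continuous (F k)) ->
  continuous (fun x => \sum_k F k x).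
Proof.
elim: m F => [|m IH] F cF.
  have -> : (fun x => \sum_(k < 0) F k x) = cst 0.
    by apply/funext => x; rewrite big_ord0.
  exact: cst_continuous.
have -> : (fun x => \sum_k F k x) =
    (fun x => F ord0 x + \sum_k F (lift ord0 k) x).
  by apply/funext => x; rewrite big_ord_recl.
by apply: continuous_add => //; exact: IH.
Qed.

Lemma continuous_du i : continuous (du u i).
Proof. by have [] := C1_du su i. Qed.
Lemma continuous_ddu i j : continuous (ddu u i j).
Proof. by have [] := C1_ddu su i j. Qed.
Lemma continuous_lap : continuous L. Proof. by have [] := C1_lap su. Qed.
Lemma continuous_gradsq : continuous G. Proof. by have [] := C1_gradsq su. Qed.
Lemma continuous_hesssq : continuous S.
Proof.
do 2 (apply: continuous_sum => ?).
under eq_fun do rewrite expr2.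
by apply: continuous_mul; exact: continuous_ddu.
Qed.
Lemma continuous_hessx i : continuous (hessx u i).
Proof. by have [] := C1_hessx su i. Qed.
Lemma continuous_ghessx : continuous C.
Proof.
apply: continuous_sum => i; apply: continuous_mul; [exact: continuous_du|exact: continuous_hessx].
Qed.
Lemma continuous_xgrad : continuous X1. Proof. by have [] := C1_xgrad su. Qed.
Lemma continuous_xhessx : continuous X2.
Proof.
apply: continuous_sum => i; apply: continuous_mul; [exact: coord_continuous|exact: continuous_hessx].
Qed.

Lemma integrableRN_lap_sqr : integrableRN (fun x => L x ^+ 2).
Proof.
have [M HM] := ddu_supp.
apply: (@integrableRN_compact _ _ _ M).
  under eq_fun do rewrite expr2.
  by apply: continuous_mul; exact: continuous_lap.
by move=> x xM; rewrite lapE big1 ?expr0n// => i _; exact: HM.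
Qed.

Lemma integrableRN_hesssq : integrableRN S.
Proof.
have [M HM] := ddu_supp.
apply: (@integrableRN_compact _ _ _ M); first exact: continuous_hesssq.
by move=> x xM; apply: big1 => i _; apply: big1 => j _; rewrite HM ?expr0n.
Qed.

Lemma xgrad_sqr_le x : x != 0 -> X1 x ^+ 2 / sqn x <= G x.
Proof.
rewrite -sqn_gt0 => t0.
by rewrite -subr_ge0; exact: (@radial_part_le _ _ (fun i => x 0 i) (fun i => du u i x) t0).
Qed.

Lemma xhessx_sqr_le x : x != 0 -> X2 x ^+ 2 / sqn x <= Y x.
Proof.
rewrite -sqn_gt0 => t0.
by rewrite -subr_ge0; exact: (@radial_part_le _ _ (fun i => x 0 i) (fun i => hessx u i x) t0).
Qed.

Lemma hesssqx_le x : x != 0 -> Y x / sqn x <= S x.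
Proof.
rewrite -sqn_gt0 => t0; rewrite mulr_suml; apply: ler_sum => i _.
have := @radial_part_le _ _ (fun i => x 0 i) (fun j => ddu u i j x) t0.
rewrite subr_ge0; congr (_ ^+ 2 / _ <= _).
by apply: eq_bigr => j _; rewrite mulrC.
Qed.

Lemma ghessx_le x : 2 * `|C x| <= G x + Y x.
Proof.
have h1 : 0 <= \sum_i (du u i x + hessx u i x) ^+ 2.
  by apply: sumr_ge0 => i _; exact: sqr_ge0.
have h2 : 0 <= \sum_i (du u i x - hessx u i x) ^+ 2.
  by apply: sumr_ge0 => i _; exact: sqr_ge0.
have E1 : \sum_i (du u i x + hessx u i x) ^+ 2 = 1 * G x + 2 * C x + 1 * Y x.
  by rewrite !mulr_sumr -!big_split/=; apply: eq_bigr => i _; ring.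
have E2 : \sum_i (du u i x - hessx u i x) ^+ 2 = 1 * G x + (- 2) * C x + 1 * Y x.
  by rewrite !mulr_sumr -!big_split/=; apply: eq_bigr => i _; ring.
rewrite E1 in h1; rewrite E2 in h2.
by have [c0|c0] := ger0P (C x); lra.
Qed.

Lemma ghessx_div_le x : x != 0 -> 2 * (`|C x| / sqn x) <= G x / sqn x + S x.
Proof.
move=> x0; have t0 : 0 < sqn x by rewrite sqn_gt0.
rewrite mulrA (le_trans (ler_wpM2r _ (ghessx_le x))) ?invr_ge0 ?(ltW t0)//.
by rewrite mulrDl lerD2l; exact: hesssqx_le.
Qed.

Lemma gradsq_ge0 x : 0 <= G x.
Proof. by apply: sumr_ge0 => i _; exact: sqr_ge0. Qed.
Lemma hesssq_ge0 x : 0 <= S x.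
Proof. by apply: sumr_ge0 => i _; apply: sumr_ge0 => j _; exact: sqr_ge0. Qed.
Lemma hesssqx_ge0 x : 0 <= Y x.
Proof. by apply: sumr_ge0 => i _; exact: sqr_ge0. Qed.
Lemma sqn_ge0 x : 0 <= sqn x.
Proof. by apply: sumr_ge0 => i _; exact: sqr_ge0. Qed.

Lemma powRN1 (t : R) : 0 < t -> t `^ (- 1) = t^-1.
Proof. by move=> t0; rewrite powR_inv1// ltW. Qed.

(** Integrating the divergence of theta |grad u|^2 x / |x|^2 bounds (N - 2) times the
left-hand side by the integral of 2 theta |<grad u, D2u x>| / |x|^2, which is at
most that of theta |grad u|^2 / |x|^2 + |D2u|^2. The error term of the cutoff has the
favourable sign. *)
Lemma cutoff_hardy e : 0 < e ->
  (integralRN (fun x => cutoff 1 e (sqn x) * G x)%R <= integralRN S)%E /\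
  integrableRN (fun x => cutoff 1 e (sqn x) * G x).
Proof.
move=> e0; have CC := C1grad_cutoff N 1 e0.
have [M HM] := du_supp.
have iG : integrableRN (fun x => cutoff 1 e (sqn x) * G x).
  apply: (@integrableRN_compact _ _ _ M).
    by apply: continuous_mul; [case: CC|exact: continuous_gradsq].
  move=> x xM; have [_ ->] := grad_vanish (fun i => HM i x xM).
  by rewrite mulr0.
split=> //.
have nd := div_radial_gradsq su du_supp CC.
have [iZ Z0] := is_divergence_integral nd.
rewrite -[leRHS]add0e -[X in (_ <= X + _)%E]Z0 -integralRND//; last exact: integrableRN_hesssq.
apply: le_integralRN => //; first exact: integrableRND iZ integrableRN_hesssq.
move=> x; have [->|x0] := eqVneq x 0.
  have [c0 d0] := cutoff0 1 e0 (lexx 0).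
  by rewrite sqn0 c0 d0 !(mul0r, mulr0) !add0r hesssq_ge0.
have t0 : 0 < sqn x by rewrite sqn_gt0.
rewrite [_ * (2 * dcutoff _ _ _)]mulrC dcutoffE// cutoffE// powRN1//.
have /andP[z0 _] := zeta_itv (sqn x) e0.
have /andP[h0 h1] := theta_itv (sqn x) e0.
have C1 := ghessx_div_le x0; have g0 := gradsq_ge0 x; have s0 := hesssq_ge0 x.
set z := zeta _ _ in z0 *; set h := theta _ _ in h0 h1 *.
set q := G x / sqn x in C1.
have q0 : 0 <= q by rewrite divr_ge0// ltW.
rewrite (_ : _ * _ + _ + _ = z * q + h * ((n - 2) * q + 2 * (C x / sqn x)) + S x);
  last first.
  by rewrite /q; field; rewrite gt_eqF.
rewrite (_ : h / sqn x * G x = h * q); last by rewrite /q; ring.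
have C2 : - `|C x| / sqn x <= C x / sqn x.
  by rewrite ler_pM2r ?invr_gt0// lerNl -normrN ler_norm.
rewrite mulNr in C2.
have n4 : 0 <= n - 4 by rewrite subr_ge0 (le_trans _ n5)// ler_nat.
have : 0 <= z * q by exact: mulr_ge0.
have : 0 <= h * ((n - 4) * q).
  by apply: mulr_ge0 => //; exact: mulr_ge0.
have : 0 <= h * (2 * (C x / sqn x) + 2 * (`|C x| / sqn x)) by apply: mulr_ge0 => //; lra.
have : 0 <= h * (q + S x - 2 * (`|C x| / sqn x)) by apply: mulr_ge0 => //; lra.
have : 0 <= (1 - h) * S x by apply: mulr_ge0 => //; lra.
nra.
Qed.

Lemma continuous_off0_gradsq_div : continuous_off0 (fun x => (sqn x)^-1 * G x).
Proof.
apply: continuous_off0M; last by apply: continuous_off0_continuous; exact: continuous_gradsq.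
apply: continuous_off0V; last by apply: continuous_off0_continuous; exact: continuous_sqn.
by move=> x; rewrite -sqn_gt0 => /gt_eqF ->.
Qed.

(** By Fatou's lemma from the bound with a cutoff. *)
Lemma integrableRN_hardy : integrableRN (fun x => (sqn x)^-1 * G x).
Proof.
apply/integrableP; split.
  by apply/measurable_EFinP; exact: (measurable_continuous_off0 continuous_off0_gradsq_div).
pose h k x := cutoff 1 k.+1%:R^-1 (sqn x) * G x.
have e0 k : 0 < k.+1%:R^-1 :> R by rewrite invr_gt0.
have h0 k x : 0 <= h k x.
  rewrite /h; have [->|x0] := eqVneq x 0.
    by have [c0 _] := cutoff0 1 (e0 k) (lexx 0); rewrite sqn0 c0 mul0r.
  have t0 : 0 < sqn x by rewrite sqn_gt0.
  rewrite cutoffE// mulr_ge0 ?gradsq_ge0// mulr_ge0 ?powR_ge0//.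
  by have /andP[] := theta_itv (sqn x) (e0 k).
have hc x : h k x @[k --> \oo] --> (sqn x)^-1 * G x.
  have [->|x0] := eqVneq x 0.
    rewrite sqn0 invr0 mul0r.
    rewrite (_ : h^~ 0 = cst 0); first exact: cvg_cst.
    apply/funext => k; rewrite /h sqn0.
    by have [-> _] := cutoff0 1 (e0 k) (lexx 0); rewrite mul0r.
  have t0 : 0 < sqn x by rewrite sqn_gt0.
  have H : (fun k : nat => theta k.+1%:R^-1 (sqn x) * ((sqn x)^-1 * G x)) @ \oo
      --> 1 * ((sqn x)^-1 * G x).
    by apply: cvgM; [exact: cvg_theta|exact: cvg_cst].
  rewrite mul1r in H.
  have E : \forall k \near \oo,
     theta k.+1%:R^-1 (sqn x) * ((sqn x)^-1 * G x) = h k x.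
    by apply: nearW => k; rewrite /h cutoffE// powRN1// mulrA.
  by apply: (cvg_trans (near_eq_cvg E)); exact: H.
have mh k : measurable_fun setT (fun t => (h k (vec t))%:E).
  have [_] := cutoff_hardy (e0 k).
  exact: measurable_int.
apply: (@le_lt_trans _ _ (\int[lebesgueN R N]_t
    limn_einf (fun k => (h k (vec t))%:E))%E).
  rewrite le_eqVlt; apply/orP; left; apply/eqP.
  apply: eq_integral => t _ /=.
  have H : (h k (vec t))%:E @[k --> \oo] --> ((sqn (vec t))^-1 * G (vec t))%:E.
    by apply: cvg_EFin; [exact: nearW|exact: hc].
  rewrite is_cvg_limn_einfE; last by apply/cvg_ex; eexists; exact: H.
  rewrite (cvg_lim _ H)// ger0_norm// mulr_ge0 ?gradsq_ge0// invr_ge0.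
  exact: sqn_ge0.
have h0E k t : setT t -> (0 <= (h k (vec t))%:E)%E by rewrite lee_fin.
apply: (le_lt_trans (fatou (lebesgueN R N) measurableT mh h0E)).
apply: (@le_lt_trans _ _ (integralRN S)).
  rewrite limn_einf_lim; apply: lime_le; first exact: is_cvg_einfs.
  apply: nearW => k.
  have [H _] := cutoff_hardy (e0 k).
  apply: le_trans H; apply: ereal_inf_lbound.
  by exists k => /=.
have /integrable_fin_num : integrableRN S by exact: integrableRN_hesssq.
by move=> /(_ measurableT); rewrite fin_numE => /andP[_]; rewrite ltey.
Qed.

End test.

(** * The weighted inequality *)

(** The positive part is integrable, so the negative part is not. *)
Lemma integralRN_nonintegrable (R : realType) (N : nat) (f g : 'rV[R]_N -> R) :
  continuous_off0 f -> integrableRN g -> (forall x, f x <= g x) -> (forall x, 0 <= g x) ->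
  ~ integrableRN f -> integralRN f = -oo%E.
Proof.
move=> cf ig fg g0 nif.
have mf : measurable_fun setT (fun t => (f (vec_of_tuple t))%:E).
  by apply/measurable_EFinP; exact: (measurable_continuous_off0 cf).
rewrite /integralRN integralE.
set F := fun t => _ in mf *.
have pos : (\int[lebesgueN R N]_t (F^\+ t) < +oo)%E.
  have /integrableP[mg] := ig; apply: le_lt_trans.
  apply: ge0_le_integral => //.
  - exact: measurable_funepos.
  - by apply: measurableT_comp.
  - move=> t _; rewrite funeposE /F /=.
    rewrite -EFin_max lee_fin ge_max normr_ge0 andbT.
    by rewrite (le_trans (fg _))// ler_norm.
have neg : (\int[lebesgueN R N]_t (F^\- t) = +oo)%E.
  apply/eqP; rewrite eq_le leey/= leNgt; apply/negP => neg.
  apply: nif; apply/integrableP; split=> //.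
  have -> : (\int[lebesgueN R N]_t `|F t| = \int[lebesgueN R N]_t (F^\+ t + F^\- t))%E.
    by apply: eq_integral => t _; have := congr1 (@^~ t) (fune_abse F).
  rewrite ge0_integralD//; last 2 first.
  - exact: measurable_funepos.
  - exact: measurable_funeneg.
  exact: lte_add_pinfty.
rewrite neg; move: pos; case: (integral _ _ _) => //.
Qed.

Section weighted.
Context (R : realType) (N : nat) (u : 'rV[R]_N -> R).
Hypothesis hN : (5 <= N)%N.
Hypothesis tu : test_function u.
Implicit Types x : 'rV[R]_N.
Local Notation T := (measurableTypeR R).
Local Notation vec := (@vec_of_tuple R N).
Local Notation n := (N%:R : R).

Let su : smooth u. Proof. by case: tu. Qed.
Let N0 : (0 < N)%N. Proof. by apply: leq_trans hN. Qed.

Local Notation L := (laplacian u).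
Local Notation G := (gradsq u).
Local Notation S := (hesssq u).
Local Notation Y := (hesssqx u).
Local Notation C := (ghessx u).
Local Notation X1 := (xgrad u).
Local Notation X2 := (xhessx u).

(** The value 0 at the origin makes the bounds below hold at every point. *)
Definition radial_wt (b : R) x := if x == 0 then 0 else sqn x `^ (- ((b + 1) / 2)).

Lemma continuous_off0_wt b : continuous_off0 (radial_wt b).
Proof.
apply: (continuous_off0_ext _ (@continuous_off0_powR R N (- ((b + 1) / 2)))) => x x0.
by rewrite /radial_wt (negbTE x0).
Qed.

Lemma wt0 b : radial_wt b 0 = 0. Proof. by rewrite /radial_wt eqxx. Qed.

Variables (b K c4 c5 c6 : R).
Let w := radial_wt b.
Let W x := (K * w x - w x ^+ 2 * sqn x) * G x.

(** The pointwise inequality behind the integral one: the difference of the two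
integrands dominates a divergence away from the origin. *)
Hypothesis residual_ge0 : forall x, x != 0 -> 0 <= L x ^+ 2 - W x -
  flux_div n b c4 c5 c6 (sqn x) (w x) (L x) (G x) (S x) (Y x) (C x) (X1 x) (X2 x).

Let csqn : continuous_off0 (@sqn R N).
Proof. by apply: continuous_off0_continuous; exact: continuous_sqn. Qed.
Let csqnV : continuous_off0 (fun x => (sqn x)^-1).
Proof. by apply: continuous_off0V => // x; rewrite -sqn_gt0 => /gt_eqF ->. Qed.
Let cw : continuous_off0 w. Proof. exact: continuous_off0_wt. Qed.
Let cL : continuous_off0 L.
Proof. by apply: continuous_off0_continuous; exact: continuous_lap. Qed.
Let cG : continuous_off0 G.
Proof. by apply: continuous_off0_continuous; exact: continuous_gradsq. Qed.
Let cC : continuous_off0 C.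
Proof. by apply: continuous_off0_continuous; exact: continuous_ghessx. Qed.
Let cX1 : continuous_off0 X1.
Proof. by apply: continuous_off0_continuous; exact: continuous_xgrad. Qed.
Let cX2 : continuous_off0 X2.
Proof. by apply: continuous_off0_continuous; exact: continuous_xhessx. Qed.

Let cW : continuous_off0 W.
Proof.
apply: continuous_off0M => //; apply: continuous_off0B.
  by apply: continuous_off0M => //; exact: continuous_off0_cst.
by apply: continuous_off0M => //; apply: continuous_off0M.
Qed.

(** Completing the square in the weight. *)
Let weight_le x : W x <= K ^+ 2 / 4 * ((sqn x)^-1 * G x).
Proof.
rewrite /W /w; have [->|x0] := eqVneq x 0.
  by rewrite wt0 sqn0 invr0 !(mul0r, mulr0, expr0n, subr0).
have t0 : 0 < sqn x by rewrite sqn_gt0.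
rewrite mulrA ler_wpM2r ?gradsq_ge0// -subr_ge0.
set v := radial_wt b x; set t := sqn x in t0 *.
rewrite (_ : _ - _ = t * (v - K / (2 * t)) ^+ 2); last by field; rewrite gt_eqF.
by rewrite mulr_ge0 ?sqr_ge0 ?ltW.
Qed.

Let iGt : integrableRN (fun x => (sqn x)^-1 * G x).
Proof. exact: integrableRN_hardy. Qed.
Let Gt_ge0 x : 0 <= (sqn x)^-1 * G x.
Proof. by rewrite mulr_ge0 ?gradsq_ge0// invr_ge0 sqn_ge0. Qed.

(** The flux through spheres, <x, V> / |x|^2, of the field V of which flux_div
is the divergence. It is the factor of the error zeta of the cutoff. *)
Let B x :=
  (n - 1) / (n - 2) * ((L x * X1 x - C x) * (sqn x)^-1)
  + (- 2 / (n - 2)) * ((L x * X1 x) * (sqn x)^-1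
                       - X1 x * X2 x * ((sqn x)^-1 * (sqn x)^-1))
  + (2 + c5) * (X1 x * X1 x * ((sqn x)^-1 * (sqn x)^-1))
  + c4 * ((sqn x)^-1 * G x) + c6 * (w x * G x).

(** Dominates every term of the flux except the one with the weight. *)
Let P x := L x ^+ 2 + S x + 2 * ((sqn x)^-1 * G x).
Let iP : integrableRN P.
Proof.
apply: integrableRND; last exact: integrableRNZ.
by apply: integrableRND; [exact: integrableRN_lap_sqr|exact: integrableRN_hesssq].
Qed.
Let P_ge0 x : 0 <= P x.
Proof. by rewrite !addr_ge0 ?sqr_ge0 ?hesssq_ge0// mulr_ge0. Qed.

Let flux_bounds x : [/\ `|L x * X1 x * (sqn x)^-1| <= P x,
  `|C x * (sqn x)^-1| <= P x,
  `|X1 x * X2 x * ((sqn x)^-1 * (sqn x)^-1)| <= P x &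
  `|X1 x * X1 x * ((sqn x)^-1 * (sqn x)^-1)| <= P x].
Proof.
have [->|x0] := eqVneq x 0.
  by rewrite sqn0 invr0 !(mul0r, mulr0) normr0; split; exact: P_ge0.
have t0 : 0 < sqn x by rewrite sqn_gt0.
have q0 := Gt_ge0 x; have s0 := hesssq_ge0 u x.
have h1 := xgrad_sqr_le u x0; have h2 := xhessx_sqr_le u x0; have h3 := hesssqx_le u x0.
have h4 := ghessx_div_le u x0; have y0 := hesssqx_ge0 u x.
rewrite /P; set t := sqn x in t0 q0 h1 h2 h3 h4 *.
have ti0 : 0 <= t^-1 by rewrite invr_ge0 ltW.
have h1' : (X1 x / t) ^+ 2 <= t^-1 * G x.
  rewrite [leLHS](_ : _ = t^-1 * (X1 x ^+ 2 / t)) ?ler_wpM2l//.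
  by field; rewrite gt_eqF.
have h2' : (X2 x / t) ^+ 2 <= S x.
  apply: le_trans h3.
  rewrite [leLHS](_ : _ = (X2 x ^+ 2 / t) / t) ?ler_wpM2r//.
  by field; rewrite gt_eqF.
have young (p q : R) : `|p * q| <= p ^+ 2 + q ^+ 2.
  have := sqr_ge0 (`|p| - `|q|); rewrite -(real_normK (num_real p)).
  rewrite -(real_normK (num_real q)) normrM.
  have := sqr_ge0 `|p|; have := sqr_ge0 `|q|; nra.
have l0 := sqr_ge0 (L x); split.
- have := young (L x) (X1 x / t); rewrite mulrA; lra.
- rewrite normrM (ger0_norm ti0); rewrite (mulrC (G x)) in h4.
  have : 0 <= `|C x| / t by rewrite mulr_ge0. lra.
- rewrite [X in `|X|](_ : _ = (X1 x / t) * (X2 x / t)); last by ring.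
  have := young (X1 x / t) (X2 x / t); lra.
- rewrite [X in `|X|](_ : _ = (X1 x / t) ^+ 2); last by ring.
  rewrite ger0_norm ?sqr_ge0//; lra.
Qed.

Let flux_integrable : integrableRN (fun x => w x * G x) ->
  continuous_off0 B /\ integrableRN B.
Proof.
move=> iwG.
have c1 : continuous_off0 (fun x => L x * X1 x * (sqn x)^-1) by do 2 apply: continuous_off0M => //.
have c2 : continuous_off0 (fun x => C x * (sqn x)^-1) by apply: continuous_off0M.
have cV2 : continuous_off0 (fun x => (sqn x)^-1 * (sqn x)^-1) by apply: continuous_off0M.
have c3 : continuous_off0 (fun x => X1 x * X2 x * ((sqn x)^-1 * (sqn x)^-1)).
  by apply: continuous_off0M => //; apply: continuous_off0M.
have c3' : continuous_off0 (fun x => X1 x * X1 x * ((sqn x)^-1 * (sqn x)^-1)).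
  by apply: continuous_off0M => //; apply: continuous_off0M.
have i1 : integrableRN (fun x => L x * X1 x * (sqn x)^-1).
  by apply: (integrableRN_dom c1 iP) => x; have [] := flux_bounds x.
have i2 : integrableRN (fun x => C x * (sqn x)^-1).
  by apply: (integrableRN_dom c2 iP) => x; have [] := flux_bounds x.
have i3 : integrableRN (fun x => X1 x * X2 x * ((sqn x)^-1 * (sqn x)^-1)).
  by apply: (integrableRN_dom c3 iP) => x; have [] := flux_bounds x.
have i3' : integrableRN (fun x => X1 x * X1 x * ((sqn x)^-1 * (sqn x)^-1)).
  by apply: (integrableRN_dom c3' iP) => x; have [] := flux_bounds x.
split.
  repeat apply: continuous_off0D; apply: continuous_off0M => //; try exact: continuous_off0_cst.
  - by apply: continuous_off0M => //; apply: continuous_off0B => //; apply: continuous_off0M.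
  - exact: continuous_off0B.
  - exact: continuous_off0M.
  - exact: continuous_off0M.
repeat apply: integrableRND; apply: integrableRNZ => //.
- have -> : (fun x => (L x * X1 x - C x) * (sqn x)^-1) =
            (fun x => L x * X1 x * (sqn x)^-1 - C x * (sqn x)^-1).
    by apply/funext => x; rewrite mulrBl.
  exact: integrableRNB.
- exact: integrableRNB.
Qed.

(** The divergence of the field V times the cutoff. Each power of |x| in V is
merged with the cutoff into one radial weight of class C1. *)
Let cutoff_div e := (fun x =>
  (n - 1) / (n - 2) * (2 * dcutoff 0 e (sqn x) * (L x * X1 x - C x) +
     cutoff 0 e (sqn x) * (L x ^+ 2 - S x))
  + ((- 2 / (n - 2)) * (2 * dcutoff 1 e (sqn x) * X1 x * (L x * sqn x - X2 x) +
      cutoff 1 e (sqn x) * (X1 x * L x - C x + X2 x * L x - Y x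
           + (n - 1) * X1 x * L x))
  + (2 * (2 * dcutoff 1 e (sqn x) * X1 x ^+ 2 +
      cutoff 1 e (sqn x) * (G x + C x + X1 x * L x))
  + (c4 * (sqn x * (2 * dcutoff 1 e (sqn x)) * G x +
      cutoff 1 e (sqn x) * (n * G x + 2 * C x))
  + (c5 * (sqn x * (2 * dcutoff 2 e (sqn x)) * X1 x ^+ 2 +
      cutoff 2 e (sqn x) * (n * X1 x ^+ 2 + 2 * X1 x * (X1 x + X2 x)))
  + c6 * (sqn x * (2 * dcutoff ((b + 1) / 2) e (sqn x)) * G x +
      cutoff ((b + 1) / 2) e (sqn x) * (n * G x + 2 * C x))))))).

Let null_cutoff_div e : 0 < e -> is_divergence (cutoff_div e).
Proof.
move=> e0; have hb := du_supp tu.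
have CC p := C1grad_cutoff N p e0.
apply: is_divergenceD; first by apply: is_divergenceZ; exact: (div_lap_grad su hb (CC 0)).
apply: is_divergenceD; first by apply: is_divergenceZ; exact: (div_xgrad_lap su hb (CC 1)).
apply: is_divergenceD; first by apply: is_divergenceZ; exact: (div_xgrad_grad su hb (CC 1)).
apply: is_divergenceD; first by apply: is_divergenceZ; exact: (div_radial_gradsq su hb (CC 1)).
apply: is_divergenceD; first by apply: is_divergenceZ; exact: (div_radial_xgradsq su hb (CC 2)).
by apply: is_divergenceZ; exact: (div_radial_gradsq su hb (CC ((b + 1) / 2))).
Qed.

(** The integrands that are compared with the divergences; dominated convergence
applies to them as e tends to 0. *)
Let g e x := theta e (sqn x) * (L x ^+ 2 - W x) + zeta e (sqn x) * B x.

Let cutoff_div_le e x : 0 < e -> cutoff_div e x <= g e x.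
Proof.
move=> e0; rewrite /cutoff_div /g; have [->|x0] := eqVneq x 0.
  have z p := cutoff0 p e0 (lexx 0).
  rewrite sqn0 /zeta /theta !(z _).1 !(z _).2.
  by rewrite !(mul0r, mulr0, add0r, addr0).
have t0 : 0 < sqn x by rewrite sqn_gt0.
have := residual_ge0 x0; rewrite /B !dcutoffE// !cutoffE//.
rewrite powRN1// oppr0 powRr0 (_ : - 2 = - 1 - 1 :> R); last by ring.
rewrite powR_pred// powRN1//.
rewrite -[sqn x `^ (- ((b + 1) / 2))]/(if false then 0 else _).
rewrite -(negbTE x0) -/(radial_wt b x) -/w.
have /andP[h0 h1] := theta_itv (sqn x) e0.
move: h0; set h := theta _ _; set z := zeta _ _ => h0 hp.
rewrite -subr_ge0; have := mulr_ge0 h0 hp; congr (0 <= _).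
have n2 : n - 2 != 0.
  by rewrite subr_eq0 (eqr_nat _ _ 2) gtn_eqF// (leq_trans _ hN).
rewrite /flux_div /W; field.
by rewrite n2 gt_eqF.
Qed.

(** If W, the weight times |grad u|^2, is not integrable its integral is -oo, because
its positive part is controlled by the Hardy inequality. Otherwise W and the Hardy
inequality control the weight |x|^(-b-1) |grad u|^2, hence the flux, and the
error of the cutoff disappears in the limit by dominated convergence. *)
Lemma weighted_ineq : (integralRN W <= integralRN (fun x => L x ^+ 2)%R)%E.
Proof.
have [iW|niW] := pselect (integrableRN W); last first.
  rewrite (integralRN_nonintegrable cW (integrableRNZ (K ^+ 2 / 4) iGt)) ?leNye//.
  by move=> x; rewrite mulr_ge0// divr_ge0 ?sqr_ge0.
have iL : integrableRN (fun x => L x ^+ 2) by exact: integrableRN_lap_sqr.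
have iwG : integrableRN (fun x => w x * G x).
  apply: (@integrableRN_dom _ _ _ (fun x => (1 + K ^+ 2) * ((sqn x)^-1 * G x) + 2 * `|W x|)).
  - exact: continuous_off0M.
  - by apply: integrableRND; apply: integrableRNZ => //; exact: integrableRN_norm.
  move=> x; rewrite /W /w; have [->|x0] := eqVneq x 0.
    by rewrite wt0 sqn0 invr0 !(mul0r, mulr0, expr0n, subr0, normr0) addr0.
  have t0 : 0 < sqn x by rewrite sqn_gt0.
  have w0 : 0 <= radial_wt b x by rewrite /radial_wt (negbTE x0) powR_ge0.
  rewrite ger0_norm ?mulr_ge0 ?gradsq_ge0//.
  have := ler_norm (- W x); rewrite normrN /W /w.
  move: (radial_wt b x) w0 (sqn x) t0 (G x) (gradsq_ge0 u x) => v v0 t t0 y y0.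
  set Wx := `|_| => hW.
  (* Two completed squares bound v y by 1/t, W and K^2/t: the first trades
     v for v^2 t, the second trades v^2 t for - W. *)
  have a1 : 0 <= t * (v - t^-1) ^+ 2 * y.
    by rewrite mulr_ge0// mulr_ge0 ?sqr_ge0// ltW.
  have a2 : 0 <= t * (K * t^-1 - v) ^+ 2 * y.
    by rewrite mulr_ge0// mulr_ge0 ?sqr_ge0// ltW.
  have e1 : t * (v - t^-1) ^+ 2 * y = v ^+ 2 * t * y - 2 * (v * y) + t^-1 * y.
    by field; rewrite gt_eqF.
  have e2 : t * (K * t^-1 - v) ^+ 2 * y =
     K ^+ 2 * (t^-1 * y) - 2 * (K * v * y) + v ^+ 2 * t * y.
    by field; rewrite gt_eqF.
  have vy : 0 <= v * y by exact: mulr_ge0.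
  rewrite e1 in a1; rewrite e2 in a2.
  rewrite mulrBl in hW; lra.
have [cBB iB] := flux_integrable iwG.
have e0 k : 0 < k.+1%:R^-1 :> R by rewrite invr_gt0.
have cg k : continuous_off0 (g k.+1%:R^-1).
  have ct : continuous_off0 (fun x => theta k.+1%:R^-1 (sqn x)).
    by apply: continuous_off0_continuous; have [] := C1grad_cutoff N 0 (e0 k).
  have cz : continuous_off0 (fun x => zeta k.+1%:R^-1 (sqn x)).
    apply: continuous_off0M; first by apply: continuous_off0M => //; exact: continuous_off0_cst.
    move=> x x0; apply: (@continuous_comp _ _ _ (@sqn R N) (dcutoff 0 k.+1%:R^-1)).
      exact: continuous_sqn.
    exact: continuous_dcutoff.
  apply: continuous_off0D; apply: continuous_off0M => //; apply: continuous_off0B => //.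
  under eq_fun do rewrite expr2.
  exact: continuous_off0M.
pose dom x := L x ^+ 2 + `|W x| + `|B x|.
have idom : integrableRN dom.
  by apply: integrableRND; [apply: integrableRND => //; exact: integrableRN_norm|exact: integrableRN_norm].
have g_dom k x : `|g k.+1%:R^-1 x| <= dom x.
  have /andP[h0 h1] := theta_itv (sqn x) (e0 k).
  have /andP[z0 z1] := zeta_itv (sqn x) (e0 k).
  rewrite /g /dom (le_trans (ler_normD _ _))// lerD//.
    rewrite normrM ger0_norm// (le_trans (ler_piMl _ h1))//.
    by rewrite (le_trans (ler_normB _ _))// ger0_norm ?sqr_ge0.
  by rewrite normrM ger0_norm// ler_piMl.
have ig k : integrableRN (g k.+1%:R^-1) by apply: (integrableRN_dom _ idom).
have cvg x : x != 0 -> g k.+1%:R^-1 x @[k --> \oo] --> L x ^+ 2 - W x.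
  move=> x0; have t0 : 0 < sqn x by rewrite sqn_gt0.
  have H : g k.+1%:R^-1 x @[k --> \oo] --> 1 * (L x ^+ 2 - W x) + 0 * B x.
    apply: cvgD; apply: cvgM; try exact: cvg_cst.
      exact: cvg_theta.
    exact: cvg_zeta.
  by move: H; rewrite mul1r mul0r addr0.
have iLW : integrableRN (fun x => L x ^+ 2 - W x) by exact: integrableRNB.
have aecvg : {ae lebesgueN R N, forall t, setT t ->
    (fun k => (g k.+1%:R^-1 (vec t))%:E) @ \oo --> (L (vec t) ^+ 2 - W (vec t))%:E}.
  apply: negligibleS (origin_null R N0) => t /= ne.
  apply: contrapT => /eqP /cvg h; apply: ne => _.
  by apply: cvg_EFin => //; exact: nearW.
have aedom : {ae lebesgueN R N, forall t k, setT t ->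
    (`|(g k.+1%:R^-1 (vec t))%:E| <= (dom (vec t))%:E)%E}.
  by apply: aeW => t k _; rewrite /= lee_fin.
have [_ _ DC] := @dominated_convergence _ _ _ (lebesgueN R N) setT measurableT
  (fun k t => (g k.+1%:R^-1 (vec t))%:E) (fun t => (L (vec t) ^+ 2 - W (vec t))%:E)
  (fun t => (dom (vec t))%:E)
  (fun k => measurable_int _ (ig k)) (measurable_int _ iLW) aecvg idom aedom.
have LW0 : (0 <= integralRN (fun x => L x ^+ 2 - W x)%R)%E.
  rewrite /integralRN -(cvg_lim _ DC)//; apply: lime_ge.
    by apply/cvg_ex; eexists; exact: DC.
  apply: nearW => k.
  have [iZ Z0] := is_divergence_integral (null_cutoff_div (e0 k)).
  by rewrite -Z0; apply: le_integralRN => // x; exact: cutoff_div_le.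
move: LW0; rewrite (_ : integralRN (fun x => L x ^+ 2 - W x) =
  (integralRN (fun x => L x ^+ 2)%R - integralRN W)%E); last first.
  exact: (integralB measurableT iL iW).
by rewrite sube_ge0// (integrable_fin_num measurableT iW)//.
Qed.

End weighted.

(** * The weights of power type *)

Section final.
Context (R : realType) (N : nat) (u : 'rV[R]_N -> R).
Hypothesis hN : (5 <= N)%N.
Hypothesis tu : test_function u.
Implicit Types x : 'rV[R]_N.
Local Notation n := (N%:R : R).

Let su : smooth u. Proof. by case: tu. Qed.
Let n5 : 5 <= n. Proof. by rewrite (ler_nat _ 5). Qed.

Definition weight (K b : R) x := K * radial_wt b x - radial_wt b x ^+ 2 * sqn x.

Lemma continuous_off0_weight K b : continuous_off0 (fun x => weight K b x * gradsq u x).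
Proof.
have cw := @continuous_off0_wt R N b.
apply: continuous_off0M; last by apply: continuous_off0_continuous; exact: continuous_gradsq.
apply: continuous_off0B; first by apply: continuous_off0M => //; exact: continuous_off0_cst.
apply: continuous_off0M; first by under eq_fun do rewrite expr2; exact: continuous_off0M.
by apply: continuous_off0_continuous; exact: continuous_sqn.
Qed.

Lemma hessian_inequalities x : x != 0 ->
  [/\ (laplacian u x - xhessx u x / sqn x) ^+ 2 <= (n - 1) *
        (hesssq u x - 2 * hesssqx u x / sqn x + xhessx u x ^+ 2 / sqn x ^+ 2),
     forall c, 0 <= hesssqx u x - xhessx u x ^+ 2 / sqn x +
       2 * c * (ghessx u x - xgrad u x * xhessx u x / sqn x) +
       c ^+ 2 * (gradsq u x - xgrad u x ^+ 2 / sqn x) &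
     0 <= gradsq u x - xgrad u x ^+ 2 / sqn x].
Proof.
rewrite -sqn_gt0 => t0; split.
- rewrite lapE; apply: (@hessian_trace_le _ _ (fun i => x 0 i) (fun i j => ddu u i j x) t0).
    by rewrite (ltr_nat _ 1) (leq_trans _ hN).
  by move=> i j; exact: ddu_sym.
- move=> c; exact: (@radial_hessian_ge0 _ _ (fun i => x 0 i) (fun i => du u i x) (fun i j => ddu u i j x) c t0).
- exact: (@radial_part_le _ _ (fun i => x 0 i) (fun i => du u i x) t0).
Qed.

Lemma weighted_linear b : (integralRN (fun x => weight (n + 1 - b) b x * gradsq u x)%R
  <= integralRN (fun x => laplacian u x ^+ 2)%R)%E.
Proof.
apply: (weighted_ineq hN tu) => x x0.
have [h1 h2 h3] := hessian_inequalities x0.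
by apply: residual_ge0_linear => //; rewrite sqn_gt0.
Qed.

Lemma weighted_newtonian b : (integralRN (fun x => weight (n + b - 1) b x * gradsq u x)%R
  <= integralRN (fun x => laplacian u x ^+ 2)%R)%E.
Proof.
apply: (weighted_ineq hN tu) => x x0.
have [h1 h2 h3] := hessian_inequalities x0.
by apply: residual_ge0_newtonian => //; rewrite sqn_gt0.
Qed.

Lemma enorm_gradE x : enorm (grad u x) ^+ 2 = gradsq u x.
Proof.
rewrite /enorm sqr_sqrtr; last by apply: sumr_ge0 => i _; exact: sqr_ge0.
by apply: eq_bigr => i _; rewrite mxE.
Qed.

Lemma enorm_powR x p : enorm x `^ p = sqn x `^ (p / 2).
Proof. by rewrite mulrC powRrM powR12_sqrt// sqn_ge0. Qed.

(** The weight in terms of |x| instead of |x|^2. *)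
Lemma weightE K b x : x != 0 ->
  weight K b x = K / enorm x `^ (b + 1) - 1 / enorm x `^ (2 * b).
Proof.
move=> x0; have t0 : 0 < sqn x by rewrite sqn_gt0.
rewrite !enorm_powR (_ : 2 * b / 2 = b); last by field.
rewrite /weight /radial_wt (negbTE x0) powRN; congr (_ - _).
rewrite -powRN expr2 -powRD; last by apply/implyP => _; rewrite gt_eqF.
rewrite (_ : _ + _ = - b - 1); last by field.
by rewrite powR_pred// divfK ?gt_eqF// powRN div1r.
Qed.

End final.

Local Open Scope ereal_scope.

Theorem corollary1p3 (R : realType) (N : nat) (hN : (5 <= N)%N)
    (u : 'rV[R]_N -> R) (hu : test_function u) :
  [/\ integralRN (fun x => `|laplacian u x| ^+ 2)%R >=
      integralRN (fun x =>
        (N%:R + 2 - enorm x ^+ 2) * enorm (grad u x) ^+ 2)%R,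
      integralRN (fun x => `|laplacian u x| ^+ 2)%R >=
      integralRN (fun x =>
        ((N%:R + 1) / enorm x - 1) * enorm (grad u x) ^+ 2)%R,
      forall b : R, (b < 1)%R ->
      integralRN (fun x => `|laplacian u x| ^+ 2)%R >=
      integralRN (fun x =>
        ((N%:R + 1 - b) / enorm x `^ (b + 1) - 1 / enorm x `^ (2 * b))
          * enorm (grad u x) ^+ 2)%R &
      forall b : R, (1 < b)%R ->
      integralRN (fun x => `|laplacian u x| ^+ 2)%R >=
      integralRN (fun x =>
        ((N%:R + b - 1) / enorm x `^ (b + 1) - 1 / enorm x `^ (2 * b))
          * enorm (grad u x) ^+ 2)%R].
Proof.
have N0 : (0 < N)%N by apply: leq_trans hN.
have LE : (fun x => `|laplacian u x| ^+ 2)%R = (fun x => laplacian u x ^+ 2)%R.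
  by apply/funext => x; rewrite real_normK// num_real.
have transfer (K b : R) (f : 'rV[R]_N -> R) :
    (forall x, x != 0 -> f x = weight K b x)%R ->
    integralRN (fun x => f x * enorm (grad u x) ^+ 2)%R =
    integralRN (fun x => weight K b x * gradsq u x)%R.
  move=> fE; apply: integralRN_eq_off0 => //; first exact: continuous_off0_weight.
  by move=> x x0; rewrite fE// enorm_gradE.
have enorm_ge0 (x : 'rV[R]_N) : (0 <= enorm x)%R by exact: sqrtr_ge0.
rewrite LE; split.
- rewrite (transfer (N%:R + 1 - (-1))%R (-1)%R); first exact: weighted_linear.
  move=> x x0; rewrite weightE// (_ : -1 + 1 = 0)%R; last by rewrite addrC subrr.
  rewrite powRr0 divr1 opprK (_ : N%:R + 1 + 1 = N%:R + 2)%R; last first.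
    by rewrite -addrA.
  congr (_ - _)%R.
  by rewrite mulrN1 powRN div1r invrK -powR_mulrn.
- rewrite (transfer (N%:R + 1 - 0)%R 0%R); first exact: weighted_linear.
  move=> x x0; rewrite weightE// subr0 add0r mulr0 powRr0 divr1.
  by rewrite powRr1.
- move=> b _; rewrite (transfer (N%:R + 1 - b)%R b); first exact: weighted_linear.
  by move=> x x0; rewrite weightE.
- move=> b _; rewrite (transfer (N%:R + b - 1)%R b); first exact: weighted_newtonian.
  by move=> x x0; rewrite weightE.
Qed.
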